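(* Let $|q|<1$ and let $k\geq 4$ be an integer. Then \[ \sum_{m_1,\dots,m_{k-2}\geq 0} \frac{q^{m_1^2+\cdots+m_{k-2}^2}}{(q)_{2m_1}} \Bigl(\prod_{j=2}^{k-3}\begin{bmatrix}m_{j-1}+m_j-m_{j+1}\\ 2m_j\end{bmatrix}\Bigr) \begin{bmatrix}m_{k-3}\\ m_{k-2}\end{bmatrix} =\frac{(q^{F_kF_{k-1}},q^{F_kF_{k-1}+1},q^{2F_kF_{k-1}+1};q^{2F_kF_{k-1}+1})_{\infty}}{(q;q)_{\infty}}. \]
   Context: $F_k$ denotes the Fibonacci numbers: $F_0=0$, $F_1=1$, $F_k=F_{k-1}+F_{k-2}$. $(x;q)_n=\prod_{i=0}^{n-1}(1-xq^i)$ (with $n=\infty$ allowed), $(q)_n=(q;q)_n$, and $(x_1,\dots,x_r;q)_\infty=\prod_{i=1}^r(x_i;q)_\infty$. The $q$-binomial coefficient is $\begin{bmatrix}n\\ m\end{bmatrix}=\frac{(q)_n}{(q)_m(q)_{n-m}}$ if $m$ and $n-m$ are nonnegative integers and $0$ otherwise. An empty product equals $1$. *)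

(* Defs.v *)
From Stdlib Require Import Reals ZArith List.
From Coquelicot Require Import Coquelicot.
Open Scope C_scope.

Fixpoint fib (n : nat) : nat :=
  match n with
  | O => O
  | S O => 1%nat
  | S ((S p) as p1) => (fib p1 + fib p)%nat
  end.

Fixpoint cprod (n : nat) (f : nat -> C) : C :=
  match n with
  | O => 1
  | S p => cprod p f * f p
  end.

Definition qpoch (x q : C) (n : nat) : C :=
  cprod n (fun i => 1 - x * Cpow q i).

Definition is_qpoch_inf (x q P : C) : Prop :=
  filterlim (fun n => qpoch x q n) eventually (locally P).

Definition qbin (q : C) (n m : Z) : C :=
  if andb (Z.leb 0 m) (Z.leb m n)
  then qpoch q q (Z.to_nat n) /
       (qpoch q q (Z.to_nat m) * qpoch q q (Z.to_nat (n - m)))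
  else 0.

Fixpoint csum (n : nat) (f : nat -> C) : C :=
  match n with
  | O => 0
  | S p => csum p f + f p
  end.

Fixpoint boxsum (d N : nat) (f : list nat -> C) : C :=
  match d with
  | O => f nil
  | S d' => csum (S N) (fun a => boxsum d' N (fun l => f (a :: l)))
  end.

(* the summand, for the tuple (m_1,...,m_{k-2}) encoded as a list l,
   m_j = nth (j-1) l *)
Definition summand (k : nat) (q : C) (l : list nat) : C :=
  let m := fun j : nat => Z.of_nat (nth (j - 1) l O) in
  Cpow q (fold_right Nat.add O (map (fun x => x * x)%nat l))
  / qpoch q q (2 * nth 0 l O)
  * cprod (k - 4) (fun i => let j := (i + 2)%nat in
                             qbin q (m (j - 1)%nat + m j - m (j + 1)%nat)%Z
                                    (2 * m j)%Z)
  * qbin q (m (k - 3)%nat) (m (k - 2)%nat).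

Definition partial_multisum (k : nat) (q : C) (N : nat) : C :=
  boxsum (k - 2) N (summand k q).

(* Main.v *)
Require Import Defs.
From Stdlib Require Import Reals ZArith List Lia Lra.
From Coquelicot Require Import Coquelicot.
Open Scope C_scope.

(** Write G_{a,b}(L,M) = [L+M+a-b; L+a][L+M-a+b; L-a]. The q-Saalschütz sum gives the Burge
    transform
      sum_i q^(i^2) [2L+M-i; 2L] G_{a,b}(L-i,i) = q^(b^2) G_{a+b,b}(L,M),
    and G_{a,b}(L,M) = G_{b,a}(M,L), so performing the innermost summation sends (a,b) to
    (a+b,a): the indices follow the Fibonacci recursion. The innermost binomial is expanded as
      [L+M; L] = sum_j (-1)^j q^(j(3j+1)/2) G_{j,j}(L,M),
    and k-3 transforms, the last one with infinite L+M, turn the sum over m_2,...,m_{k-2} into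
    a single sum over j with a = F_{k-1} j. The accumulated exponents add up through
    F_1^2 + ... + F_n^2 = F_n F_{n+1}. The sum over m_1 is Bailey's lemma, and Jacobi's triple
    product evaluates the remaining theta series. *)

(** * Limits and finite sums *)

(** A summand vanishes unless m_1 >= m_2 >= ... >= m_{k-2}. Once m_1 <= N is fixed, the other sums
    are complete inside the box and only the sum over m_1 is infinite: each box sum is exactly a
    partial sum of a simple series, and convergence is settled in one variable. The case q = 0 is
    included, so no negative power of q may occur. This forces the pairing of j with -j in every
    bilateral sum; reciprocals 1/(q)_n set to 0 for n < 0 take the place of summation ranges. Three
    finite identities carry the algebra: q-Saalschütz, the expansion of the binomial and a finite
    triple product. Each is an induction on a parameter, with a telescoping certificate for the
    step. Every infinite identity is the limit of a finite one in a further parameter; a bound on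
    1/(q)_n uniform in n gives the nonvanishing of (q)_infinity and enters the geometric
    majorants. *)

Definition clim (u : nat -> C) (l : C) : Prop :=
  forall eps : R, (0 < eps)%R ->
  exists N, forall n, (N <= n)%nat -> (Cmod (u n - l) < eps)%R.

Lemma clim_filterlim (u : nat -> C) (l : C) :
  clim u l <-> filterlim u eventually (locally l).
Proof.
  split.
  - intros H P HP.
    apply locally_C in HP. destruct HP as [d Hd].
    destruct (H d (cond_pos d)) as [N HN].
    exists N. intros n Hn. apply Hd. exact (HN n Hn).
  - intros H eps He.
    assert (HP : locally (T := C_UniformSpace) l (fun y => (Cmod (y - l) < eps)%R)).
    { apply locally_C. exists (mkposreal eps He). intros y Hy. exact Hy. }
    destruct (H _ HP) as [N HN]. exists N. exact HN.
Qed.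

Lemma clim_const (c : C) : clim (fun _ => c) c.
Proof.
  intros eps He. exists 0%nat. intros n _.
  replace (c - c) with (RtoC 0) by ring. rewrite Cmod_0. exact He.
Qed.

Lemma clim_ext (u v : nat -> C) (l : C) :
  (forall n, u n = v n) -> clim u l -> clim v l.
Proof.
  intros E H eps He. destruct (H eps He) as [N HN].
  exists N. intros n Hn. rewrite <- E. auto.
Qed.

Lemma clim_eq (u : nat -> C) (l m : C) : clim u l -> l = m -> clim u m.
Proof. intros H <-. exact H. Qed.

Lemma clim_subseq (u : nat -> C) (phi : nat -> nat) (l : C) :
  (forall n, (n <= phi n)%nat) -> clim u l -> clim (fun n => u (phi n)) l.
Proof.
  intros Hp H eps He. destruct (H eps He) as [N HN].
  exists N. intros n Hn. apply HN. specialize (Hp n). lia.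
Qed.

Lemma clim_unshift (u : nat -> C) (k : nat) (l : C) :
  clim (fun n => u (n + k)%nat) l -> clim u l.
Proof.
  intros H eps He. destruct (H eps He) as [N HN].
  exists (N + k)%nat. intros n Hn.
  replace n with (n - k + k)%nat by lia. apply HN. lia.
Qed.

Lemma clim_plus (u v : nat -> C) (l m : C) :
  clim u l -> clim v m -> clim (fun n => u n + v n) (l + m).
Proof.
  intros Hu Hv eps He.
  destruct (Hu (eps / 2)%R ltac:(lra)) as [N HN].
  destruct (Hv (eps / 2)%R ltac:(lra)) as [M HM].
  exists (N + M)%nat. intros n Hn.
  replace (u n + v n - (l + m)) with ((u n - l) + (v n - m)) by ring.
  eapply Rle_lt_trans; [apply Cmod_triangle|].
  specialize (HN n ltac:(lia)). specialize (HM n ltac:(lia)). lra.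
Qed.

Lemma clim_zero_mult (u v : nat -> C) (K : R) :
  (forall n, (Cmod (v n) <= K)%R) -> clim u 0 -> clim (fun n => u n * v n) 0.
Proof.
  intros Hv Hu eps He.
  assert (HK : (0 <= K)%R) by (eapply Rle_trans; [apply Cmod_ge_0 | apply (Hv 0%nat)]).
  destruct (Hu (eps / (K + 1))%R) as [N HN]; [apply Rdiv_lt_0_compat; lra|].
  exists N. intros n Hn. specialize (HN n Hn).
  replace (u n - 0) with (u n) in HN by ring.
  replace (u n * v n - 0) with (u n * v n) by ring.
  rewrite Cmod_mult.
  apply Rle_lt_trans with (Cmod (u n) * (K + 1))%R.
  - apply Rmult_le_compat_l; [apply Cmod_ge_0|]. specialize (Hv n). lra.
  - apply (Rmult_lt_compat_r (K + 1)) in HN; [|lra].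
    unfold Rdiv in HN. rewrite Rmult_assoc, Rinv_l in HN; lra.
Qed.

Lemma clim_sub0 (u : nat -> C) (l : C) :
  clim u l <-> clim (fun n => u n - l) 0.
Proof.
  split; intros H eps He; destruct (H eps He) as [N HN]; exists N; intros n Hn;
    specialize (HN n Hn); [replace (u n - l - 0) with (u n - l) by ring |
    replace (u n - l) with (u n - l - 0) by ring]; exact HN.
Qed.

Lemma clim_scal (u : nat -> C) (c l : C) :
  clim u l -> clim (fun n => c * u n) (c * l).
Proof.
  intros H. apply clim_sub0.
  apply clim_ext with (fun n => (u n - l) * c); [intros; ring|].
  apply clim_zero_mult with (Cmod c); [intros; lra|]. now apply clim_sub0 in H.
Qed.

Lemma clim_bounded (u : nat -> C) (l : C) :
  clim u l -> exists N, forall n, (Cmod (u (n + N)%nat) <= Cmod l + 1)%R.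
Proof.
  intros H. destruct (H 1%R ltac:(lra)) as [N HN]. exists N. intros n.
  replace (u (n + N)%nat) with (l + (u (n + N)%nat - l)) by ring.
  eapply Rle_trans; [apply Cmod_triangle|].
  specialize (HN (n + N)%nat ltac:(lia)). lra.
Qed.

Lemma clim_mult (u v : nat -> C) (l m : C) :
  clim u l -> clim v m -> clim (fun n => u n * v n) (l * m).
Proof.
  intros Hu Hv. destruct (clim_bounded v m Hv) as [k Hk].
  apply clim_unshift with k.
  apply clim_ext with
    (fun n => (u (n + k)%nat - l) * v (n + k)%nat + l * v (n + k)%nat);
    [intros; ring|].
  replace (l * m) with (0 + l * m) by ring.
  apply clim_plus.
  - apply clim_zero_mult with (Cmod m + 1)%R; [exact Hk|].
    apply (clim_subseq (fun n => u n - l) (fun n => n + k)%nat); [intros; lia|].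
    now apply clim_sub0 in Hu.
  - apply clim_scal. apply (clim_subseq v (fun n => n + k)%nat); [intros; lia | exact Hv].
Qed.

Lemma clim_unique (u : nat -> C) (l m : C) : clim u l -> clim u m -> l = m.
Proof.
  intros Hl Hm. apply clim_filterlim in Hl. apply clim_filterlim in Hm.
  exact (filterlim_locally_unique (V := C_NormedModule) u l m Hl Hm).
Qed.

Lemma clim_le (u : nat -> C) (l : C) (b : R) :
  (forall n, (Cmod (u n) <= b)%R) -> clim u l -> (Cmod l <= b)%R.
Proof.
  intros Hb H. apply Rnot_lt_le. intros Hlt.
  destruct (H (Cmod l - b)%R ltac:(lra)) as [N HN].
  specialize (HN N ltac:(lia)). specialize (Hb N).
  assert (Ht := Cmod_triangle (u N) (- (u N - l))).
  rewrite Cmod_opp in Ht.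
  replace (u N + - (u N - l)) with l in Ht by ring. lra.
Qed.

Lemma csum_ext (n : nat) (f g : nat -> C) :
  (forall i, (i < n)%nat -> f i = g i) -> csum n f = csum n g.
Proof.
  induction n as [|n IH]; intros H; simpl; [reflexivity|].
  rewrite IH, H; [reflexivity | lia | intros; apply H; lia].
Qed.

Lemma csum_zero (n : nat) (f : nat -> C) :
  (forall i, (i < n)%nat -> f i = 0) -> csum n f = 0.
Proof.
  induction n as [|n IH]; intros H; simpl; [reflexivity|].
  rewrite IH, H; [ring | lia | intros; apply H; lia].
Qed.

Lemma csum_scal (n : nat) (c : C) (f : nat -> C) :
  csum n (fun i => c * f i) = c * csum n f.
Proof. induction n as [|n IH]; simpl; [|rewrite IH]; ring. Qed.

Lemma csum_plus (n : nat) (f g : nat -> C) :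
  csum n (fun i => f i + g i) = csum n f + csum n g.
Proof. induction n as [|n IH]; simpl; [|rewrite IH]; ring. Qed.

Lemma csum_swap (n m : nat) (f : nat -> nat -> C) :
  csum n (fun i => csum m (fun j => f i j)) = csum m (fun j => csum n (fun i => f i j)).
Proof.
  induction n as [|n IH]; simpl.
  - symmetry. now apply csum_zero.
  - rewrite IH. symmetry. apply csum_plus.
Qed.

Lemma csum_comb (n : nat) (a b : C) (f g : nat -> C) :
  a * csum n f - b * csum n g = csum n (fun i => a * f i - b * g i).
Proof. induction n as [|n IH]; simpl; [|rewrite <- IH]; ring. Qed.

Lemma csum_telescope (n : nat) (f g : nat -> C) :
  (forall i, (i < n)%nat -> f i = g (S i) - g i) -> csum n f = g n - g 0%nat.
Proof.
  intros H. rewrite (csum_ext n f _ H). clear H.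
  induction n as [|n IH]; simpl; [|rewrite IH]; ring.
Qed.

Lemma csum_split (a b : nat) (f : nat -> C) :
  csum (a + b) f = csum a f + csum b (fun i => f (a + i)%nat).
Proof.
  induction b as [|b IH]; [rewrite Nat.add_0_r; simpl; ring|].
  rewrite Nat.add_succ_r. simpl. rewrite IH. ring.
Qed.

Lemma csum_head (n : nat) (f : nat -> C) :
  csum (S n) f = f 0%nat + csum n (fun i => f (S i)).
Proof.
  change (S n) with (1 + n)%nat. rewrite csum_split. simpl. ring.
Qed.

Lemma csum_trunc (a n : nat) (f : nat -> C) :
  (a <= n)%nat -> (forall i, (a <= i < n)%nat -> f i = 0) -> csum n f = csum a f.
Proof.
  intros Ha H. replace n with (a + (n - a))%nat by lia.
  rewrite csum_split, (csum_zero (n - a)); [ring|]. intros i Hi. apply H. lia.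
Qed.

Lemma clim_csum (n : nat) (f : nat -> nat -> C) (g : nat -> C) :
  (forall j, (j < n)%nat -> clim (fun t => f t j) (g j)) ->
  clim (fun t => csum n (f t)) (csum n g).
Proof.
  induction n as [|n IH]; intros H; simpl; [apply clim_const|].
  apply clim_plus; [apply IH; intros; apply H; lia | apply H; lia].
Qed.

Lemma csum_sum_n (f : nat -> C) (n : nat) :
  csum (S n) f = sum_n (G := C_AbelianMonoid) f n.
Proof.
  induction n as [|n IH].
  - rewrite sum_O. simpl. ring.
  - rewrite sum_Sn, <- IH. reflexivity.
Qed.

Lemma csum_Cmod_geom (K rho : R) (n m : nat) (f : nat -> C) :
  (0 <= K)%R -> (0 <= rho < 1)%R ->
  (forall i, (Cmod (f i) <= K * rho ^ (m + i))%R) ->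
  (Cmod (csum n f) <= K / (1 - rho) * rho ^ m)%R.
Proof.
  intros HK Hr H.
  assert (Hp : (0 <= rho ^ m)%R) by (apply pow_le; lra).
  (* The factor 1 - rho^n makes the bound inductive; it is dropped at the end. *)
  assert (HG : (Cmod (csum n f) * (1 - rho) <= K * rho ^ m * (1 - rho ^ n))%R).
  { induction n as [|n IH].
    - simpl. rewrite Cmod_0. lra.
    - simpl csum. assert (Ht := Cmod_triangle (csum n f) (f n)).
      specialize (H n). rewrite pow_add in H.
      apply Rle_trans with ((Cmod (csum n f) + K * (rho ^ m * rho ^ n)) * (1 - rho))%R.
      + apply Rmult_le_compat_r; lra.
      + simpl. nra. }
  assert (Hn : (0 <= rho ^ n)%R) by (apply pow_le; lra).
  apply Rmult_le_reg_r with (1 - rho)%R; [lra|].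
  replace (K / (1 - rho) * rho ^ m * (1 - rho))%R with (K * rho ^ m)%R by (field; lra).
  assert (0 <= K * rho ^ m)%R by (apply Rmult_le_pos; lra). nra.
Qed.

Lemma csum_geom_converges (K rho : R) (f : nat -> C) :
  (0 <= rho < 1)%R -> (forall i, (Cmod (f i) <= K * rho ^ i)%R) ->
  exists l, clim (fun n => csum n f) l.
Proof.
  intros Hr H.
  assert (Hex : ex_series (V := C_CompleteNormedModule) f).
  { apply (ex_series_le (V := C_CompleteNormedModule) f (fun i => K * rho ^ i)%R).
    - exact H.
    - apply (ex_series_scal (V := R_NormedModule) K).
      apply ex_series_geom. rewrite Rabs_pos_eq; lra. }
  destruct Hex as [l Hl]. exists l.
  apply clim_unshift with 1%nat.
  apply clim_ext with (sum_n (G := C_AbelianMonoid) f).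
  - intros n. rewrite Nat.add_1_r. symmetry. apply csum_sum_n.
  - apply clim_filterlim. exact Hl.
Qed.

Lemma geom_small (K rho eps : R) :
  (0 <= K)%R -> (0 <= rho < 1)%R -> (0 < eps)%R -> exists m : nat, (K * rho ^ m < eps)%R.
Proof.
  intros HK Hr He.
  assert (Hlim := is_lim_seq_geom rho ltac:(rewrite Rabs_pos_eq; lra)).
  apply is_lim_seq_spec in Hlim.
  destruct (Hlim (mkposreal (eps / (K + 1)) ltac:(apply Rdiv_lt_0_compat; lra))) as [m Hm].
  exists m. specialize (Hm m (le_n m)). simpl in Hm.
  rewrite Rminus_0_r in Hm. apply Rabs_lt_between in Hm. destruct Hm as [_ Hm].
  apply (Rmult_lt_compat_r (K + 1)) in Hm; [|lra].
  unfold Rdiv in Hm. rewrite Rmult_assoc, Rinv_l in Hm by lra.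
  assert (0 <= rho ^ m)%R by (apply pow_le; lra). nra.
Qed.

(* Tannery's theorem with a geometric majorant. *)
Lemma clim_dominated (K rho : R) (f : nat -> nat -> C) (g : nat -> C) :
  (0 <= K)%R -> (0 <= rho < 1)%R ->
  (forall n j, (Cmod (f n j) <= K * rho ^ j)%R) ->
  (forall j, clim (fun n => f n j) (g j)) ->
  exists l, clim (fun n => csum n g) l /\ clim (fun n => csum (S n) (f n)) l.
Proof.
  intros HK Hr Hf Hg.
  assert (Hgb : forall j, (Cmod (g j) <= K * rho ^ j)%R)
    by (intros j; apply clim_le with (fun n => f n j); auto).
  destruct (csum_geom_converges K rho g Hr Hgb) as [l Hl].
  exists l. split; [exact Hl|]. apply clim_sub0. intros eps He.
  set (K' := (K / (1 - rho))%R).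
  assert (HK' : (0 <= K')%R) by (apply Rdiv_le_0_compat; lra).
  destruct (geom_small K' rho (eps / 4) HK' Hr ltac:(lra)) as [m Hm].
  destruct (clim_csum m f g (fun j _ => Hg j) (eps / 4)%R ltac:(lra)) as [N1 HN1].
  destruct (Hl (eps / 4)%R ltac:(lra)) as [N2 HN2].
  exists (m + N1 + N2)%nat. intros n Hn.
  specialize (HN1 n ltac:(lia)). specialize (HN2 (S n) ltac:(lia)).
  assert (Hsp : forall h, csum (S n) h = csum m h + csum (S n - m) (fun i => h (m + i)%nat))
    by (intros h; rewrite <- csum_split; f_equal; lia).
  rewrite Hsp in HN2 |- *.
  assert (B1 := csum_Cmod_geom K rho (S n - m) m (fun i => f n (m + i)%nat) HK Hr
                  (fun i => Hf n (m + i)%nat)).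
  assert (B2 := csum_Cmod_geom K rho (S n - m) m (fun i => g (m + i)%nat) HK Hr
                  (fun i => Hgb (m + i)%nat)).
  fold K' in B1, B2.
  set (a := csum m (f n)) in *. set (b := csum m g) in *.
  set (c := csum (S n - m) (fun i => f n (m + i)%nat)) in *.
  set (d := csum (S n - m) (fun i => g (m + i)%nat)) in *.
  (* Four errors, each below eps/4: the heads (a - b), the limit series (b + d - l), and the two
     tails c and d, which are small uniformly in n. *)
  replace (a + c - l - 0) with (((a - b) + (b + d - l)) + (c + - d)) by ring.
  eapply Rle_lt_trans; [apply Cmod_triangle|].
  assert (T1 := Cmod_triangle (a - b) (b + d - l)).
  assert (T2 := Cmod_triangle c (- d)). rewrite Cmod_opp in T2. lra.
Qed.

(** * The q-Saalschütz sum *)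

(* Negative exponents give 1; [zpow] and [qfac] are only meaningful at nonnegative integers. *)
Definition zpow (q : C) (z : Z) : C := Cpow q (Z.to_nat z).

Definition qfac (q : C) (z : Z) : C := qpoch q q (Z.to_nat z).

(* The value 0 at negative integers makes all sums below terminate naturally. *)
Definition iqfac (q : C) (z : Z) : C := if (z <? 0)%Z then 0 else / qfac q z.

Lemma Cmult_eq_cancel (c x y : C) : c <> 0 -> c * x = c * y -> x = y.
Proof.
  intros Hc H. replace x with (/ c * (c * x)) by (field; exact Hc).
  rewrite H. field. exact Hc.
Qed.

(** Creative telescoping: t and t' are the summands at two consecutive values of a parameter, g is
    the certificate, and the conclusion is a first-order recurrence for the sum. *)
Lemma csum_wz (n : nat) (a b : C) (t t' g : nat -> C) :
  (forall i, (i < n)%nat -> a * t' i - b * t i = g (S i) - g i) ->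
  g 0%nat = 0 -> g n = 0 -> a * csum n t' = b * csum n t.
Proof.
  intros H H0 Hn.
  assert (E := csum_telescope n _ g H). rewrite <- csum_comb, H0, Hn in E.
  replace (a * csum n t') with (a * csum n t' - b * csum n t + b * csum n t) by ring.
  rewrite E. ring.
Qed.

Lemma zpow_add (q : C) (x y : Z) :
  (0 <= x)%Z -> (0 <= y)%Z -> zpow q (x + y) = zpow q x * zpow q y.
Proof. intros. unfold zpow. rewrite Z2Nat.inj_add by lia. apply Cpow_add_r. Qed.

Lemma zpow_0 (q : C) : zpow q 0 = 1.
Proof. reflexivity. Qed.

Lemma zpow_of_nat (q : C) (n : nat) : zpow q (Z.of_nat n) = Cpow q n.
Proof. unfold zpow. now rewrite Nat2Z.id. Qed.

Lemma Cmod_pow_le (q : C) (n : nat) : (Cmod q < 1)%R -> (Cmod (Cpow q n) <= 1)%R.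
Proof.
  intros H. rewrite Cmod_pow. rewrite <- (pow1 n). apply pow_incr.
  split; [apply Cmod_ge_0 | lra].
Qed.

Lemma Cmod_pow_lt (q : C) (n : nat) :
  (Cmod q < 1)%R -> (1 <= n)%nat -> (Cmod (Cpow q n) <= Cmod q)%R.
Proof.
  intros H Hn. destruct n as [|n]; [lia|]. rewrite Cpow_S, Cmod_mult.
  assert (Hp := Cmod_pow_le q n H). assert (H0 := Cmod_ge_0 q). nra.
Qed.

Lemma one_sub_neq_0 (x : C) : (Cmod x < 1)%R -> 1 - x <> 0.
Proof.
  intros H E. assert (x = 1) as -> by (replace x with (1 - (1 - x)) by ring; rewrite E; ring).
  rewrite Cmod_1 in H. lra.
Qed.

Lemma zpow_neq_1 (q : C) (z : Z) :
  (Cmod q < 1)%R -> (0 < z)%Z -> 1 - zpow q z <> 0.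
Proof.
  intros Hq Hz. apply one_sub_neq_0.
  apply Rle_lt_trans with (Cmod q); [apply Cmod_pow_lt; [exact Hq | lia] | exact Hq].
Qed.

Lemma qpoch_neq_0 (q : C) (n : nat) : (Cmod q < 1)%R -> qpoch q q n <> 0.
Proof.
  intros Hq. induction n as [|n IH]; unfold qpoch in *; simpl.
  - apply C1_nz.
  - apply Cmult_neq_0; [exact IH|]. rewrite <- Cpow_S.
    apply one_sub_neq_0. apply Rle_lt_trans with (Cmod q); [|exact Hq].
    apply Cmod_pow_lt; [exact Hq | auto with arith].
Qed.

Lemma qfac_0 (q : C) : qfac q 0 = 1.
Proof. reflexivity. Qed.

Lemma qfac_succ (q : C) (z : Z) :
  (0 <= z)%Z -> qfac q (z + 1) = qfac q z * (1 - zpow q (z + 1)).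
Proof.
  intros Hz. unfold qfac, zpow. replace (Z.to_nat (z + 1)) with (S (Z.to_nat z)) by lia.
  rewrite Cpow_S. reflexivity.
Qed.

Lemma iqfac_neg (q : C) (z : Z) : (z < 0)%Z -> iqfac q z = 0.
Proof. intros H. unfold iqfac. apply Z.ltb_lt in H. now rewrite H. Qed.

Lemma iqfac_pos (q : C) (z : Z) : (0 <= z)%Z -> iqfac q z = / qfac q z.
Proof. intros H. unfold iqfac. apply Z.ltb_ge in H. now rewrite H. Qed.

Lemma iqfac_0 (q : C) : iqfac q 0 = 1.
Proof. unfold iqfac, qfac, qpoch. simpl. field. Qed.

Lemma qfac_iqfac (q : C) (z : Z) :
  (Cmod q < 1)%R -> (0 <= z)%Z -> qfac q z * iqfac q z = 1.
Proof.
  intros Hq Hz. rewrite iqfac_pos by exact Hz. apply Cinv_r. now apply qpoch_neq_0.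
Qed.

Lemma iqfac_pred (q : C) (z : Z) :
  (Cmod q < 1)%R -> iqfac q (z - 1) = (1 - zpow q z) * iqfac q z.
Proof.
  intros Hq. destruct (Z_lt_le_dec z 0) as [H|H].
  - rewrite !iqfac_neg by lia. ring.
  - destruct (Z.eq_dec z 0) as [->|Hz].
    + rewrite iqfac_neg, zpow_0 by lia. ring.
    + rewrite !iqfac_pos by lia.
      assert (E := qfac_succ q (z - 1) ltac:(lia)).
      replace (z - 1 + 1)%Z with z in E by ring. rewrite E.
      field. split; [apply zpow_neq_1; [exact Hq|lia] | now apply qpoch_neq_0].
Qed.

Lemma qbin_eq (q : C) (n m : Z) :
  (Cmod q < 1)%R -> qbin q n m = qfac q n * iqfac q m * iqfac q (n - m).
Proof.
  intros Hq. unfold qbin.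
  destruct (Z.leb_spec 0 m); simpl; [|rewrite (iqfac_neg q m) by lia; ring].
  destruct (Z.leb_spec m n); simpl; [|rewrite (iqfac_neg q (n - m)) by lia; ring].
  rewrite !iqfac_pos by lia. unfold qfac.
  field. split; now apply qpoch_neq_0.
Qed.

(* Zeilberger's recurrence in m for the summand [t], with WZ certificate [g]. *)
Lemma saalschutz_step (q : C) (X n m B s : Z) :
  (Cmod q < 1)%R -> (0 <= m)%Z -> (0 <= B)%Z -> (0 <= s <= n)%Z -> (n <= X)%Z ->
  let t m := zpow q (s * (s + B)) * qfac q (X + n + m + B - s) * iqfac q s
             * iqfac q (s + B) * iqfac q (m - s) * iqfac q (X - s) * iqfac q (n - s) in
  let g s := - zpow q (s * (s + B) + m + 1 - s) * qfac q (X + n + m + B + 1 - s)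
             * iqfac q (s - 1) * iqfac q (s - 1 + B) * iqfac q (m + 1 - s)
             * iqfac q (X - s) * iqfac q (n - s) in
  (1 - zpow q (m + 1)) * (1 - zpow q (m + B + 1)) * t (m + 1)%Z
  - (1 - zpow q (X + m + B + 1)) * (1 - zpow q (n + m + B + 1)) * t m
  = g (s + 1)%Z - g s.
Proof.
  intros Hq Hm HB Hs HX t g. unfold t, g. clear t g.
  (* For s > m + 1 every term vanishes; otherwise all exponents below are nonnegative, as [zpow_add]
     requires. *)
  destruct (Z_lt_le_dec (m + 1) s) as [H|H].
  { rewrite (iqfac_neg q (m + 1 - s)), (iqfac_neg q (m - s)),
      (iqfac_neg q (m + 1 - (s + 1))) by lia. ring. }
  replace (m - s)%Z with (m + 1 - s - 1)%Z by ring.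
  replace (m + 1 - (s + 1))%Z with (m + 1 - s - 1)%Z by ring.
  replace (X - (s + 1))%Z with (X - s - 1)%Z by ring.
  replace (n - (s + 1))%Z with (n - s - 1)%Z by ring.
  replace (s - 1 + B)%Z with (s + B - 1)%Z by ring.
  replace (s + 1 - 1)%Z with s by ring.
  replace (X + n + m + B + 1 - (s + 1))%Z with (X + n + m + B - s)%Z by ring.
  replace (X + n + (m + 1) + B - s)%Z with (X + n + m + B - s + 1)%Z by ring.
  replace (X + n + m + B + 1 - s)%Z with (X + n + m + B - s + 1)%Z by ring.
  rewrite qfac_succ by lia. rewrite !iqfac_pred by exact Hq.
  replace (s + 1 + B - 1)%Z with (s + B)%Z by ring.
  (* Every remaining power of q is a monomial in these atoms, which turns the claim into a
     polynomial identity. *)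
  set (S := zpow q s). set (b := zpow q B). set (m' := zpow q (m + 1 - s)).
  set (x := zpow q (X - s)). set (n' := zpow q (n - s)).
  set (e := zpow q (s * (s + B))).
  replace (zpow q (m + 1)) with (m' * S)
    by (unfold m', S; rewrite <- !zpow_add by lia; f_equal; ring).
  replace (zpow q (m + B + 1)) with (m' * S * b)
    by (unfold m', S, b; rewrite <- !zpow_add by lia; f_equal; ring).
  replace (zpow q (X + m + B + 1)) with (m' * S * b * (x * S))
    by (unfold m', S, b, x; rewrite <- !zpow_add by lia; f_equal; ring).
  replace (zpow q (n + m + B + 1)) with (m' * S * b * (n' * S))
    by (unfold m', S, b, n'; rewrite <- !zpow_add by lia; f_equal; ring).
  replace (zpow q (X + n + m + B - s + 1)) with (m' * b * (n' * S) * (x * S))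
    by (unfold m', S, b, n', x; rewrite <- !zpow_add by lia; f_equal; ring).
  replace (zpow q (s + B)) with (S * b)
    by (unfold S, b; rewrite <- !zpow_add by lia; f_equal; ring).
  replace (zpow q (s * (s + B) + m + 1 - s)) with (e * m')
    by (unfold e, m'; rewrite <- !zpow_add by nia; f_equal; ring).
  replace (zpow q ((s + 1) * (s + 1 + B) + m + 1 - (s + 1))) with (e * m' * S * S * b)
    by (unfold e, m', S, b; rewrite <- !zpow_add by nia; f_equal; ring).
  ring.
Qed.

(** Induction on m: at m = 0 only s = 0 survives, and both sides obey the same first-order
    recurrence, whose leading coefficient is nonzero because |q| < 1. Since the sum ends at n <= X,
    the exponents X - s and n - s stay nonnegative. *)
Lemma saalschutz (q : C) (X n B : Z) (m : nat) :
  (Cmod q < 1)%R -> (0 <= B)%Z -> (0 <= n <= X)%Z ->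
  csum (S (Z.to_nat n)) (fun i => let s := Z.of_nat i in let m := Z.of_nat m in
     zpow q (s * (s + B)) * qfac q (X + n + m + B - s) * iqfac q s
       * iqfac q (s + B) * iqfac q (m - s) * iqfac q (X - s) * iqfac q (n - s))
  = let m := Z.of_nat m in
    qfac q (X + m + B) * qfac q (n + m + B) * qfac q (X + n + B)
    * iqfac q m * iqfac q X * iqfac q n
    * iqfac q (m + B) * iqfac q (X + B) * iqfac q (n + B).
Proof.
  intros Hq HB Hn. cbv zeta. induction m as [|m IH].
  - change (Z.of_nat 0) with 0%Z.
    rewrite (csum_trunc 1) by
      (try lia; intros i Hi; rewrite (iqfac_neg q (0 - Z.of_nat i)) by lia; ring).
    simpl csum. change (Z.of_nat 0) with 0%Z.
    rewrite !Z.add_0_r, !Z.sub_0_r, !Z.add_0_l, zpow_0, iqfac_0.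
    transitivity ((qfac q (X + B) * iqfac q (X + B)) * (qfac q (n + B) * iqfac q (n + B))
      * (qfac q (X + n + B) * iqfac q B * iqfac q X * iqfac q n)); [|ring].
    rewrite !qfac_iqfac by (auto; lia). ring.
  - set (c := Z.of_nat m) in *.
    replace (Z.of_nat (S m)) with (c + 1)%Z by lia.
    assert (Hc : (0 <= c)%Z) by lia.
    apply Cmult_eq_cancel with ((1 - zpow q (c + 1)) * (1 - zpow q (c + B + 1)));
      [apply Cmult_neq_0; apply zpow_neq_1; auto; lia|].
    erewrite csum_wz; [rewrite IH | | |].
    + assert (E1 := iqfac_pred q (c + 1) Hq).
      assert (E2 := iqfac_pred q (c + B + 1) Hq).
      rewrite Z.add_simpl_r in E1, E2. rewrite E1, E2.
      replace (X + (c + 1) + B)%Z with (X + c + B + 1)%Z by ring.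
      replace (n + (c + 1) + B)%Z with (n + c + B + 1)%Z by ring.
      replace (c + 1 + B)%Z with (c + B + 1)%Z by ring.
      rewrite !qfac_succ by lia.
      instantiate (1 := (1 - zpow q (X + c + B + 1)) * (1 - zpow q (n + c + B + 1))).
      ring.
    + intros i Hi.
      assert (W := saalschutz_step q X n c B (Z.of_nat i) Hq Hc HB ltac:(lia) (proj2 Hn)).
      cbv zeta in W. eapply eq_trans; [exact W|]. clear W.
      replace (Z.of_nat i + 1)%Z with (Z.of_nat (S i)) by lia.
      instantiate (1 := fun i => let s := Z.of_nat i in
        - zpow q (s * (s + B) + c + 1 - s) * qfac q (X + n + c + B + 1 - s)
             * iqfac q (s - 1) * iqfac q (s - 1 + B) * iqfac q (c + 1 - s)
             * iqfac q (X - s) * iqfac q (n - s)).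
      reflexivity.
    (* The certificate vanishes at both ends: through 1/(q)_(s-1) at s = 0 and through 1/(q)_(n-s)
       at s = n + 1. *)
    + simpl. rewrite (iqfac_neg q (-1)) by lia. ring.
    + cbv beta zeta. rewrite (iqfac_neg q (n - Z.of_nat _)) by lia. ring.
Qed.

(** * Infinite products and limiting cases *)

Lemma cprod_bound (c rho : R) (f : nat -> C) :
  (0 <= c)%R -> (0 <= rho < 1)%R ->
  (forall i, (Cmod (f i) <= 1 + c * rho ^ i)%R) ->
  forall n, (Cmod (cprod n f) <= exp (c / (1 - rho)))%R.
Proof.
  intros Hc Hr H n.
  (* The inductive bound comes from 1 + x <= exp x; its exponent is the partial geometric sum c (1 +
     rho + ... + rho^(n-1)). *)
  apply Rle_trans with (exp (c / (1 - rho) * (1 - rho ^ n))).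
  - induction n as [|n IH]; simpl.
    + rewrite Cmod_1, Rminus_diag, Rmult_0_r, exp_0. lra.
    + replace (c / (1 - rho) * (1 - rho * rho ^ n))%R
        with (c / (1 - rho) * (1 - rho ^ n) + c * rho ^ n)%R by (field; lra).
      rewrite Cmod_mult, exp_plus.
      apply Rmult_le_compat; try apply Cmod_ge_0; [exact IH|].
      eapply Rle_trans; [apply H|]. apply exp_ineq1_le.
  - assert (0 <= rho ^ n)%R by (apply pow_le; lra).
    assert (0 <= c / (1 - rho))%R by (apply Rdiv_le_0_compat; lra).
    destruct (Req_dec (c / (1 - rho) * (1 - rho ^ n)) (c / (1 - rho))) as [->|Hne]; [lra|].
    left. apply exp_increasing. nra.
Qed.

Lemma qpoch_bound (x q : C) :
  (Cmod q < 1)%R -> exists K, (0 < K)%R /\ forall n, (Cmod (qpoch x q n) <= K)%R.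
Proof.
  intros Hq. exists (exp (Cmod x / (1 - Cmod q))). split; [apply exp_pos|].
  apply cprod_bound; [apply Cmod_ge_0 | split; [apply Cmod_ge_0 | exact Hq] |].
  intros i. unfold Cminus. eapply Rle_trans; [apply Cmod_triangle|].
  rewrite Cmod_opp, Cmod_1, Cmod_mult, Cmod_pow. lra.
Qed.

(** The increments -x (x;q)_n q^n have a geometric majorant because the partial products are
    bounded. Arguing with increments instead of logarithms admits vanishing factors. *)
Lemma qpoch_converges (x q : C) : (Cmod q < 1)%R -> exists P, clim (qpoch x q) P.
Proof.
  intros Hq. destruct (qpoch_bound x q Hq) as [K [HK HB]].
  destruct (csum_geom_converges (Cmod x * K) (Cmod q)
              (fun n => qpoch x q (S n) - qpoch x q n)) as [l Hl].
  - split; [apply Cmod_ge_0 | exact Hq].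
  - intros n. unfold qpoch. simpl. fold (qpoch x q n).
    replace (qpoch x q n * (1 - x * Cpow q n) - qpoch x q n)
      with (- (x * qpoch x q n * Cpow q n)) by ring.
    rewrite Cmod_opp, !Cmod_mult, Cmod_pow.
    apply Rmult_le_compat_r; [apply pow_le, Cmod_ge_0|].
    apply Rmult_le_compat_l; [apply Cmod_ge_0 | apply HB].
  - exists (l + 1).
    apply clim_ext with
      (fun n => csum n (fun n => qpoch x q (S n) - qpoch x q n) + 1).
    + intros n. rewrite (csum_telescope n _ (qpoch x q)) by reflexivity. unfold qpoch. simpl. ring.
    + apply clim_plus; [exact Hl | apply clim_const].
Qed.

Lemma cprod_inv (f : nat -> C) (n : nat) :
  (forall i, f i <> 0) -> cprod n (fun i => / f i) = / cprod n f /\ cprod n f <> 0.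
Proof.
  intros H. induction n as [|n [IH1 IH2]]; simpl.
  - split; [field | apply C1_nz].
  - rewrite IH1. split; [field; auto | now apply Cmult_neq_0].
Qed.

(** For y = |q|^(i+1), 1/(1-y) = 1 + y/(1-y) <= 1 + |q|^i/(1-|q|), because y is at most both |q| and
    |q|^i. This is the hypothesis of [cprod_bound] with c = 1/(1-|q|). *)
Lemma iqfac_bound (q : C) :
  (Cmod q < 1)%R -> exists K, (0 < K)%R /\ forall z, (Cmod (iqfac q z) <= K)%R.
Proof.
  intros Hq. assert (H0 := Cmod_ge_0 q).
  exists (exp (1 / (1 - Cmod q) / (1 - Cmod q))). split; [apply exp_pos|].
  intros z. destruct (Z_lt_le_dec z 0) as [Hz|Hz].
  { rewrite iqfac_neg, Cmod_0 by exact Hz. left. apply exp_pos. }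
  rewrite iqfac_pos by exact Hz. unfold qfac, qpoch.
  assert (Hnz : forall i, 1 - q * Cpow q i <> 0).
  { intros i. rewrite <- Cpow_S. apply one_sub_neq_0.
    apply Rle_lt_trans with (Cmod q); [apply Cmod_pow_lt; auto with arith | exact Hq]. }
  rewrite <- (proj1 (cprod_inv _ (Z.to_nat z) Hnz)).
  apply cprod_bound; [|lra|].
  { apply Rdiv_le_0_compat; lra. }
  intros i. rewrite Cmod_inv by apply Hnz.
  assert (Hp : (0 <= Cmod q ^ i)%R) by (apply pow_le; lra).
  assert (Hle : (Cmod q * Cmod q ^ i <= Cmod q)%R).
  { assert (H := Cmod_pow_le q i Hq). rewrite Cmod_pow in H. nra. }
  assert (Hle' : (Cmod q * Cmod q ^ i <= Cmod q ^ i)%R) by nra.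
  assert (Hlow : (1 - Cmod q * Cmod q ^ i <= Cmod (1 - q * Cpow q i))%R).
  { assert (Ht := Cmod_triangle (1 - q * Cpow q i) (q * Cpow q i)).
    replace (1 - q * Cpow q i + q * Cpow q i) with (RtoC 1) in Ht by ring.
    rewrite Cmod_1, Cmod_mult, Cmod_pow in Ht. lra. }
  apply Rle_trans with (/ (1 - Cmod q * Cmod q ^ i))%R.
  { apply Rinv_le_contravar; lra. }
  set (y := (Cmod q * Cmod q ^ i)%R) in *.
  apply Rmult_le_reg_r with ((1 - y) * (1 - Cmod q))%R; [nra|].
  replace (/ (1 - y) * ((1 - y) * (1 - Cmod q)))%R with (1 - Cmod q)%R by (field; lra).
  replace ((1 + 1 / (1 - Cmod q) * Cmod q ^ i) * ((1 - y) * (1 - Cmod q)))%R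
    with ((1 - y) * (1 - Cmod q + Cmod q ^ i))%R by (field; lra).
  nra.
Qed.

Lemma clim_qfac (q P : C) (c : Z) :
  clim (qpoch q q) P -> clim (fun t => qfac q (Z.of_nat t + c)) P.
Proof.
  intros H. apply clim_unshift with (Z.to_nat (- c)).
  apply clim_ext with (fun t => qpoch q q (t + Z.to_nat c)%nat).
  - intros t. unfold qfac. f_equal. lia.
  - apply (clim_subseq (qpoch q q) (fun t => t + Z.to_nat c)%nat); [intros; lia | exact H].
Qed.

(** The reciprocals stay bounded, so a zero limit would make the constant product (q)_n * 1/(q)_n =
    1 tend to 0. *)
Lemma qpoch_lim_neq_0 (q P : C) : (Cmod q < 1)%R -> clim (qpoch q q) P -> P <> 0.
Proof.
  intros Hq H E. subst P. destruct (iqfac_bound q Hq) as [K [HK HB]].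
  assert (H1 : clim (fun n => qpoch q q n * iqfac q (Z.of_nat n)) 0).
  { apply clim_zero_mult with K; [intros; apply HB | exact H]. }
  apply C1_nz. apply clim_unique with (2 := H1).
  apply clim_ext with (fun _ => 1); [|apply clim_const].
  intros n. rewrite <- (qfac_iqfac q (Z.of_nat n) Hq) by lia.
  unfold qfac. now rewrite Nat2Z.id.
Qed.

Lemma clim_iqfac (q P : C) (c : Z) :
  (Cmod q < 1)%R -> clim (qpoch q q) P -> clim (fun t => iqfac q (Z.of_nat t + c)) (/ P).
Proof.
  intros Hq H. assert (HP := qpoch_lim_neq_0 q P Hq H).
  destruct (iqfac_bound q Hq) as [K [HK HB]].
  apply clim_sub0.
  apply clim_unshift with (Z.to_nat (- c)).
  (* This is 1/u - 1/P = -(1/P) (u - P)/u; the shift keeps the argument nonnegative, where [iqfac]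
     is a true reciprocal. *)
  apply clim_ext with (fun t => (- / P) *
     ((qfac q (Z.of_nat (t + Z.to_nat (- c))%nat + c) - P)
       * iqfac q (Z.of_nat (t + Z.to_nat (- c))%nat + c))).
  - intros t. assert (E := qfac_iqfac q (Z.of_nat (t + Z.to_nat (- c))%nat + c) Hq ltac:(lia)).
    set (u := qfac q _) in *. set (v := iqfac q _) in *.
    replace (- / P * ((u - P) * v)) with (v * (/ P * P) - / P * (u * v)) by ring.
    rewrite E. field. exact HP.
  - replace (RtoC 0) with (- / P * 0) by ring. apply clim_scal.
    apply (clim_subseq (fun t => (qfac q (Z.of_nat t + c) - P) * iqfac q (Z.of_nat t + c))
             (fun t => t + Z.to_nat (- c))%nat); [intros; lia|].
    apply clim_zero_mult with K; [intros; apply HB|].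
    pose proof (clim_qfac q P c H) as H1. now apply clim_sub0 in H1.
Qed.

(* Let m tend to infinity in the q-Saalschütz sum. *)
Lemma vandermonde (q : C) (X n B : Z) :
  (Cmod q < 1)%R -> (0 <= B)%Z -> (0 <= n <= X)%Z ->
  csum (S (Z.to_nat n)) (fun i => let s := Z.of_nat i in
     zpow q (s * (s + B)) * iqfac q s * iqfac q (s + B)
       * iqfac q (X - s) * iqfac q (n - s))
  = qfac q (X + n + B) * iqfac q X * iqfac q n * iqfac q (X + B) * iqfac q (n + B).
Proof.
  intros Hq HB Hn. destruct (qpoch_converges q q Hq) as [P HP].
  assert (HP0 := qpoch_lim_neq_0 q P Hq HP).
  set (h := fun i => let s := Z.of_nat i in
     zpow q (s * (s + B)) * iqfac q s * iqfac q (s + B)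
       * iqfac q (X - s) * iqfac q (n - s)).
  (* On both sides the factors depending on m are grouped in pairs of one [qfac] and one [iqfac],
     each pair tending to P * /P = 1. *)
  apply clim_unique with (fun m => csum (S (Z.to_nat n)) (fun i =>
     h i * (qfac q (Z.of_nat m + (X + n + B - Z.of_nat i))
       * iqfac q (Z.of_nat m + (0 - Z.of_nat i))))).
  - apply clim_csum. intros i Hi.
    apply clim_eq with (h i * (P * / P));
      [|change (h i * (P * / P) = h i); field; exact HP0].
    apply clim_scal, clim_mult; [now apply clim_qfac | now apply clim_iqfac].
  - apply clim_ext with (fun m => let m := Z.of_nat m in
      (qfac q (X + n + B) * iqfac q X * iqfac q n * iqfac q (X + B) * iqfac q (n + B)) *
      ((qfac q (m + (X + B)) * iqfac q (m + 0)) * (qfac q (m + (n + B)) * iqfac q (m + B)))).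
    + intros m. cbv zeta.
      eapply eq_trans; [|eapply eq_trans; [symmetry; apply (saalschutz q X n B m Hq HB Hn)|]].
      * cbv zeta. rewrite Z.add_0_r.
        replace (X + Z.of_nat m + B)%Z with (Z.of_nat m + (X + B))%Z by ring.
        replace (n + Z.of_nat m + B)%Z with (Z.of_nat m + (n + B))%Z by ring. ring.
      * apply csum_ext. intros i Hi. unfold h. cbv zeta.
        replace (X + n + Z.of_nat m + B - Z.of_nat i)%Z
          with (Z.of_nat m + (X + n + B - Z.of_nat i))%Z by ring.
        replace (Z.of_nat m + (0 - Z.of_nat i))%Z with (Z.of_nat m - Z.of_nat i)%Z by ring.
        ring.
    + apply clim_eq with ((qfac q (X + n + B) * iqfac q X * iqfac q n * iqfac q (X + B)
        * iqfac q (n + B)) * ((P * / P) * (P * / P))).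
      2:{ rewrite Cinv_r by exact HP0. ring. }
      apply clim_scal, clim_mult; apply clim_mult;
        (now apply clim_qfac) || (now apply clim_iqfac).
Qed.

(* Let X tend to infinity in [vandermonde]. *)
Lemma vandermonde_inf (q : C) (n B : Z) :
  (Cmod q < 1)%R -> (0 <= B)%Z -> (0 <= n)%Z ->
  csum (S (Z.to_nat n)) (fun i => let s := Z.of_nat i in
     zpow q (s * (s + B)) * iqfac q s * iqfac q (s + B) * iqfac q (n - s))
  = iqfac q n * iqfac q (n + B).
Proof.
  intros Hq HB Hn. destruct (qpoch_converges q q Hq) as [P HP].
  assert (HP0 := qpoch_lim_neq_0 q P Hq HP).
  set (h := fun i => let s := Z.of_nat i in
     zpow q (s * (s + B)) * iqfac q s * iqfac q (s + B) * iqfac q (n - s)).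
  (* As X grows, both sides of [vandermonde] keep one unmatched reciprocal tending to 1/P, which is
     cancelled here. Below, X = x + n, so that n <= X. *)
  apply Cmult_eq_cancel with (/ P).
  { intros E. apply C1_nz. replace (RtoC 1) with (P * / P) by (field; exact HP0).
    rewrite E. ring. }
  rewrite <- csum_scal.
  apply clim_unique with (fun x => csum (S (Z.to_nat n)) (fun i =>
     h i * iqfac q (Z.of_nat x + (n - Z.of_nat i)))).
  - apply clim_csum. intros i Hi.
    apply clim_eq with (h i * / P); [|apply Cmult_comm].
    apply clim_scal. now apply clim_iqfac.
  - apply clim_ext with (fun x => let x := Z.of_nat x in
      (iqfac q n * iqfac q (n + B)) * ((qfac q (x + (n + n + B)) * iqfac q (x + n))
        * iqfac q (x + (n + B)))).
    + intros x. cbv zeta.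
      eapply eq_trans; [|eapply eq_trans;
        [symmetry; apply (vandermonde q (Z.of_nat x + n) n B Hq HB); lia|]].
      * replace (Z.of_nat x + n + n + B)%Z with (Z.of_nat x + (n + n + B))%Z by ring.
        replace (Z.of_nat x + n + B)%Z with (Z.of_nat x + (n + B))%Z by ring. ring.
      * apply csum_ext. intros i Hi. unfold h. cbv zeta.
        replace (Z.of_nat x + n - Z.of_nat i)%Z
          with (Z.of_nat x + (n - Z.of_nat i))%Z by ring. ring.
    + apply clim_eq with ((iqfac q n * iqfac q (n + B)) * ((P * / P) * / P)).
      2:{ rewrite Cinv_r by exact HP0. ring. }
      apply clim_scal, clim_mult; [apply clim_mult|];
        (now apply clim_qfac) || (now apply clim_iqfac).
Qed.

(** * The Burge transform *)

(** The exponent j(j-1)/2, so that [tri j + j * j] is the pentagonal number j(3j-1)/2. *)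
Fixpoint tri (j : nat) : nat := match j with O => O | S i => (tri i + i)%nat end.

(* The terms j and -j of sum_j (-1)^j q^(j(3j+1)/2) taken together; they are polynomial in q,
   which spares a separate treatment of q = 0. *)
Definition theta (q : C) (j : nat) : C :=
  match j with
  | O => 1
  | S _ => Cpow (-(1)) j * Cpow q (tri j + j * j) * (1 + Cpow q j)
  end.

Lemma zpow_to_nat (q : C) (n : nat) (z : Z) : Z.of_nat n = z -> Cpow q n = zpow q z.
Proof. intros <-. symmetry. apply zpow_of_nat. Qed.

(* WZ certificate for [seed], at j = i. *)
Definition seed_cert (q : C) (L M j : Z) (i : nat) : C :=
  - Cpow (-(1)) i * zpow q (Z.of_nat (tri i) + j * j + M + 1 - j) * qfac q (L + M)
    * iqfac q (L - j) * iqfac q (L + j - 1) * iqfac q (M + 1 - j) * iqfac q (M + j).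

Lemma seed_step (q : C) (L M : Z) (i : nat) :
  (Cmod q < 1)%R -> (0 <= M)%Z -> (1 <= Z.of_nat i <= L)%Z ->
  let j := Z.of_nat i in
  let t M := theta q i * qfac q (L + M) * iqfac q (L - j) * iqfac q (L + j)
             * iqfac q (M - j) * iqfac q (M + j) in
  (1 - zpow q (M + 1)) * t (M + 1)%Z - 1 * t M
  = seed_cert q L M (j + 1) (S i) - seed_cert q L M j i.
Proof.
  intros Hq HM Hj j t. unfold t, seed_cert. clear t.
  change (Z.of_nat i) with j in Hj.
  destruct (Z_lt_le_dec (M + 1) j) as [H|H].
  { rewrite (iqfac_neg q (M + 1 - j)), (iqfac_neg q (M - j)),
      (iqfac_neg q (M + 1 - (j + 1))) by lia. ring. }
  replace (M - j)%Z with (M + 1 - j - 1)%Z by ring.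
  replace (M + 1 - (j + 1))%Z with (M + 1 - j - 1)%Z by ring.
  replace (L - (j + 1))%Z with (L - j - 1)%Z by ring.
  replace (L + (j + 1) - 1)%Z with (L + j)%Z by ring.
  replace (L + (M + 1))%Z with (L + M + 1)%Z by ring.
  replace (M + (j + 1))%Z with (M + j + 1)%Z by ring.
  replace (M + 1 + j)%Z with (M + j + 1)%Z by ring.
  replace (iqfac q (M + j)) with ((1 - zpow q (M + j + 1)) * iqfac q (M + j + 1))
    by (rewrite <- iqfac_pred by exact Hq; f_equal; ring).
  rewrite qfac_succ by lia. rewrite !iqfac_pred by exact Hq.
  assert (Hth : theta q i = Cpow (-(1)) i * zpow q (Z.of_nat (tri i) + j * j) * (1 + zpow q j)).
  { unfold theta. destruct i as [|i']; [lia|].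
    f_equal; [f_equal|f_equal]; apply zpow_to_nat; lia. }
  rewrite Hth, Cpow_S. clear Hth.
  replace (Z.of_nat (tri (S i))) with (Z.of_nat (tri i) + j)%Z by (simpl tri; lia).
  set (u := Z.of_nat (tri i)). assert (Hu : (0 <= u)%Z) by lia. clearbody u.
  set (J := zpow q j). set (m' := zpow q (M + 1 - j)). set (l := zpow q (L - j)).
  set (e := zpow q (u + j * j)).
  replace (zpow q (M + 1)) with (m' * J)
    by (unfold m', J; rewrite <- !zpow_add by lia; f_equal; ring).
  replace (zpow q (M + j + 1)) with (m' * J * J)
    by (unfold m', J; rewrite <- !zpow_add by lia; f_equal; ring).
  replace (zpow q (L + j)) with (l * J * J)
    by (unfold l, J; rewrite <- !zpow_add by lia; f_equal; ring).
  replace (zpow q (L + M + 1)) with (l * J * (m' * J))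
    by (unfold l, m', J; rewrite <- !zpow_add by lia; f_equal; ring).
  replace (zpow q (u + j * j + M + 1 - j)) with (e * m')
    by (unfold e, m'; rewrite <- !zpow_add by nia; f_equal; ring).
  replace (zpow q (u + j + (j + 1) * (j + 1) + M + 1 - (j + 1)))
    with (e * m' * J * J * J)
    by (unfold e, m', J; rewrite <- !zpow_add by nia; f_equal; ring).
  ring.
Qed.

(** A doubly finite form of Euler's pentagonal number theorem, which is its limit as L and M grow.
    The induction is on M; at M = 0 only j = 0 survives. *)
Lemma seed (q : C) (L : Z) (m : nat) :
  (Cmod q < 1)%R -> (0 <= L)%Z ->
  csum (S (Z.to_nat L)) (fun i => let j := Z.of_nat i in let M := Z.of_nat m in
     theta q i * qfac q (L + M) * iqfac q (L - j) * iqfac q (L + j)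
             * iqfac q (M - j) * iqfac q (M + j))
  = iqfac q L * iqfac q (Z.of_nat m).
Proof.
  intros Hq HL. cbv zeta. induction m as [|m IH].
  - rewrite (csum_trunc 1) by
      (try lia; intros i Hi; rewrite (iqfac_neg q (Z.of_nat 0 - Z.of_nat i)) by lia; ring).
    simpl csum. change (Z.of_nat 0) with 0%Z.
    rewrite !Z.add_0_r, !Z.sub_0_r, iqfac_0.
    transitivity ((qfac q L * iqfac q L) * iqfac q L); [ring|].
    rewrite qfac_iqfac by assumption. ring.
  - set (M := Z.of_nat m) in *. replace (Z.of_nat (S m)) with (M + 1)%Z by lia.
    assert (HM : (0 <= M)%Z) by lia.
    assert (E1 := iqfac_pred q (M + 1) Hq). rewrite Z.add_simpl_r in E1.
    apply Cmult_eq_cancel with (1 - zpow q (M + 1)); [apply zpow_neq_1; auto; lia|].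
    erewrite csum_wz; [rewrite IH | | |].
    + rewrite E1. instantiate (1 := 1). ring.
    + intros i Hi.
      (* [theta q 0] stands for one term, not for two as at j > 0. The certificate is therefore
         reset to 0 at j = 0, and the first step is checked on its own. *)
      instantiate (1 := fun i => match i with O => 0 | S _ => seed_cert q L M (Z.of_nat i) i end).
      destruct i as [|i].
      * unfold seed_cert. change (Z.of_nat 0) with 0%Z. change (Z.of_nat 1) with 1%Z.
        simpl theta. simpl tri. change (Z.of_nat 0) with 0%Z.
        rewrite !Z.sub_0_r, !Z.add_0_r, !Z.add_simpl_r.
        replace (L + (M + 1))%Z with (L + M + 1)%Z by ring.
        rewrite qfac_succ, iqfac_pred, E1 by (auto; lia).
        replace (0 + 1 * 1 + M)%Z with (M + 1)%Z by ring.
        replace (zpow q (L + M + 1)) with (zpow q L * zpow q (M + 1))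
          by (rewrite <- !zpow_add by lia; f_equal; ring).
        rewrite Cpow_1_r. ring.
      * assert (W := seed_step q L M (S i) Hq HM ltac:(lia)).
        cbv zeta in W. eapply eq_trans; [exact W|]. clear W.
        replace (Z.of_nat (S i) + 1)%Z with (Z.of_nat (S (S i))) by lia. reflexivity.
    + reflexivity.
    + cbv beta iota. unfold seed_cert. rewrite (iqfac_neg q (L - Z.of_nat _)) by lia. ring.
Qed.

(* G_{a,b}(m, p-m) in the notation of the header. *)
Definition Phi (q : C) (a b p m : Z) : C :=
  qfac q (p + a - b) * qfac q (p - a + b) * iqfac q (m + a) * iqfac q (m - a)
  * iqfac q (p - m - b) * iqfac q (p - m + b).

(** Terms with i < a vanish, so put i = a + s. Then i*i = a*a + s(s + 2a) splits off q^(a*a), and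
    the rest is q-Saalschütz with B = 2a, n = m - a - b, X = m - a + b and mu = p - m - a in the
    role of its m. In the form (p, m) the arguments of [Phi] are two consecutive summation
    variables, so the result feeds the next transform directly. *)
Lemma burge (q : C) (a b p m : Z) (N : nat) :
  (Cmod q < 1)%R -> (0 <= a)%Z -> (0 <= b)%Z -> (0 <= m <= Z.of_nat N)%Z ->
  csum (S N) (fun i => let i := Z.of_nat i in
     zpow q (i * i) * qbin q (p + m - i) (2 * m) * Phi q a b m i)
  = zpow q (a * a) * Phi q (a + b) a p m.
Proof.
  intros Hq Ha Hb Hm. unfold Phi.
  (* A nonzero term needs a <= i <= m - b and i <= p - m. If m < a + b, or next if p - m < a, there
     is none, and the right side vanishes too. *)
  destruct (Z_lt_le_dec (m - a - b) 0) as [Hn|Hn].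
  { rewrite (iqfac_neg q (m - (a + b))) by lia.
    rewrite csum_zero; [ring|]. intros i Hi. cbv zeta.
    destruct (Z_lt_le_dec (Z.of_nat i) a).
    - rewrite (iqfac_neg q (Z.of_nat i - a)) by lia. ring.
    - rewrite (iqfac_neg q (m - Z.of_nat i - b)) by lia. ring. }
  destruct (Z_lt_le_dec (p - m - a) 0) as [Hmu|Hmu].
  { rewrite (iqfac_neg q (p - m - a)) by lia.
    rewrite csum_zero; [ring|]. intros i Hi. cbv zeta.
    rewrite qbin_eq by exact Hq.
    destruct (Z_lt_le_dec (Z.of_nat i) a).
    - rewrite (iqfac_neg q (Z.of_nat i - a)) by lia. ring.
    - rewrite (iqfac_neg q (p + m - Z.of_nat i - 2 * m)) by lia. ring. }
  replace (S N) with (Z.to_nat a + (S N - Z.to_nat a))%nat by lia.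
  rewrite csum_split, csum_zero, Cplus_0_l
    by (intros i Hi; cbv zeta; rewrite (iqfac_neg q (Z.of_nat i - a)) by lia; ring).
  set (n := (m - a - b)%Z) in *.
  rewrite (csum_trunc (S (Z.to_nat n))) by
    (try lia; intros i Hi; cbv zeta;
     rewrite (iqfac_neg q (m - Z.of_nat (Z.to_nat a + i) - b)) by lia; ring).
  set (X := (n + 2 * b)%Z). set (mu := (p - m - a)%Z) in *.
  assert (Sa := saalschutz q X n (2 * a) (Z.to_nat mu) Hq ltac:(lia) ltac:(lia)).
  cbv zeta in Sa. rewrite Z2Nat.id in Sa by lia.
  transitivity (zpow q (a * a) * (qfac q (m + a - b) * qfac q (m - a + b) * iqfac q (2 * m)) *
    (qfac q (X + mu + 2 * a) * qfac q (n + mu + 2 * a) *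
     qfac q (X + n + 2 * a) * iqfac q mu * iqfac q X * iqfac q n *
     iqfac q (mu + 2 * a) * iqfac q (X + 2 * a) * iqfac q (n + 2 * a))).
  - rewrite <- Sa. rewrite <- csum_scal. apply csum_ext. intros i Hi. cbv zeta.
    set (s := Z.of_nat i). rewrite qbin_eq by exact Hq.
    replace (Z.of_nat (Z.to_nat a + i)) with (a + s)%Z by lia.
    replace (zpow q ((a + s) * (a + s))) with (zpow q (a * a) * zpow q (s * (s + 2 * a)))
      by (rewrite <- !zpow_add by nia; f_equal; ring).
    replace (p + m - (a + s) - 2 * m)%Z with (mu - s)%Z by (unfold mu; ring).
    replace (a + s - a)%Z with s by ring.
    replace (m - (a + s) - b)%Z with (n - s)%Z by (unfold n; ring).
    replace (m - (a + s) + b)%Z with (X - s)%Z by (unfold X, n; ring).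
    replace (a + s + a)%Z with (s + 2 * a)%Z by ring.
    replace (p + m - (a + s))%Z with (X + n + mu + 2 * a - s)%Z by (unfold X, n, mu; ring).
    ring.
  - replace (X + mu + 2 * a)%Z with (p + b)%Z by (unfold X, n, mu; ring).
    replace (n + mu + 2 * a)%Z with (p - b)%Z by (unfold n, mu; ring).
    replace (X + n + 2 * a)%Z with (2 * m)%Z by (unfold X, n; ring).
    replace (mu + 2 * a)%Z with (p - m + a)%Z by (unfold mu; ring).
    replace (X + 2 * a)%Z with (m + a + b)%Z by (unfold X, n; ring).
    replace (n + 2 * a)%Z with (m + a - b)%Z by (unfold n; ring).
    replace X with (m - a + b)%Z by (unfold X, n; ring).
    replace (p + (a + b) - a)%Z with (p + b)%Z by ring.
    replace (p - (a + b) + a)%Z with (p - b)%Z by ring.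
    replace (m - (a + b))%Z with n by (unfold n; ring).
    replace (m + (a + b))%Z with (m + a + b)%Z by ring.
    fold mu.
    transitivity (zpow q (a * a) * (qfac q (m + a - b) * iqfac q (m + a - b))
      * (qfac q (m - a + b) * iqfac q (m - a + b)) * (qfac q (2 * m) * iqfac q (2 * m))
      * (qfac q (p + b) * qfac q (p - b) * iqfac q (m + a + b) * iqfac q n
         * iqfac q mu * iqfac q (p - m + a))); [ring|].
    rewrite !qfac_iqfac by (auto; lia). ring.
Qed.

(* [burge] with p infinite. *)
Lemma burge_inf (q : C) (a b m : Z) (N : nat) :
  (Cmod q < 1)%R -> (0 <= a)%Z -> (0 <= b)%Z -> (0 <= m <= Z.of_nat N)%Z ->
  csum (S N) (fun i => let i := Z.of_nat i in zpow q (i * i) * Phi q a b m i)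
  = zpow q (a * a) * (qfac q (2 * m) * iqfac q (m + (a + b)) * iqfac q (m - (a + b))).
Proof.
  intros Hq Ha Hb Hm. unfold Phi.
  destruct (Z_lt_le_dec (m - a - b) 0) as [Hn|Hn].
  { rewrite (iqfac_neg q (m - (a + b))) by lia.
    rewrite csum_zero; [ring|]. intros i Hi. cbv zeta.
    destruct (Z_lt_le_dec (Z.of_nat i) a).
    - rewrite (iqfac_neg q (Z.of_nat i - a)) by lia. ring.
    - rewrite (iqfac_neg q (m - Z.of_nat i - b)) by lia. ring. }
  replace (S N) with (Z.to_nat a + (S N - Z.to_nat a))%nat by lia.
  rewrite csum_split, csum_zero, Cplus_0_l
    by (intros i Hi; cbv zeta; rewrite (iqfac_neg q (Z.of_nat i - a)) by lia; ring).
  set (n := (m - a - b)%Z) in *.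
  rewrite (csum_trunc (S (Z.to_nat n))) by
    (try lia; intros i Hi; cbv zeta;
     rewrite (iqfac_neg q (m - Z.of_nat (Z.to_nat a + i) - b)) by lia; ring).
  set (X := (n + 2 * b)%Z).
  assert (V := vandermonde q X n (2 * a) Hq ltac:(lia) ltac:(lia)). cbv zeta in V.
  transitivity (zpow q (a * a) * (qfac q (m + a - b) * qfac q (m - a + b)) *
    (qfac q (X + n + 2 * a) * iqfac q X * iqfac q n * iqfac q (X + 2 * a)
     * iqfac q (n + 2 * a))).
  - rewrite <- V. rewrite <- csum_scal. apply csum_ext. intros i Hi. cbv zeta.
    set (s := Z.of_nat i).
    replace (Z.of_nat (Z.to_nat a + i)) with (a + s)%Z by lia.
    replace (zpow q ((a + s) * (a + s))) with (zpow q (a * a) * zpow q (s * (s + 2 * a)))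
      by (rewrite <- !zpow_add by nia; f_equal; ring).
    replace (a + s - a)%Z with s by ring.
    replace (m - (a + s) - b)%Z with (n - s)%Z by (unfold n; ring).
    replace (m - (a + s) + b)%Z with (X - s)%Z by (unfold X, n; ring).
    replace (a + s + a)%Z with (s + 2 * a)%Z by ring.
    ring.
  - replace (X + n + 2 * a)%Z with (2 * m)%Z by (unfold X, n; ring).
    replace (X + 2 * a)%Z with (m + (a + b))%Z by (unfold X, n; ring).
    replace (n + 2 * a)%Z with (m + a - b)%Z by (unfold n; ring).
    replace X with (m - a + b)%Z by (unfold X, n; ring).
    replace (m - (a + b))%Z with n by (unfold n; ring).
    transitivity (zpow q (a * a) * (qfac q (m + a - b) * iqfac q (m + a - b))
      * (qfac q (m - a + b) * iqfac q (m - a + b))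
      * (qfac q (2 * m) * iqfac q (m + (a + b)) * iqfac q n)); [ring|].
    rewrite !qfac_iqfac by (auto; lia). ring.
Qed.

(* Bailey's lemma, at the level of a single term. *)
Lemma durfee (q : C) (t : Z) (N : nat) :
  (Cmod q < 1)%R -> (0 <= t)%Z ->
  csum (S N) (fun i => let i := Z.of_nat i in
     zpow q (i * i) * iqfac q (i - t) * iqfac q (i + t) * iqfac q (Z.of_nat N - i))
  = zpow q (t * t) * (iqfac q (Z.of_nat N - t) * iqfac q (Z.of_nat N + t)).
Proof.
  intros Hq Ht. set (M := Z.of_nat N).
  destruct (Z_lt_le_dec (M - t) 0) as [Hn|Hn].
  { rewrite (iqfac_neg q (M - t)) by lia.
    rewrite csum_zero; [ring|]. intros i Hi. cbv zeta.
    rewrite (iqfac_neg q (Z.of_nat i - t)) by lia. ring. }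
  replace (S N) with (Z.to_nat t + (S (Z.to_nat (M - t))))%nat by lia.
  rewrite csum_split, csum_zero, Cplus_0_l
    by (intros i Hi; cbv zeta; rewrite (iqfac_neg q (Z.of_nat i - t)) by lia; ring).
  assert (V := vandermonde_inf q (M - t) (2 * t) Hq ltac:(lia) ltac:(lia)). cbv zeta in V.
  replace (M + t)%Z with (M - t + 2 * t)%Z by ring.
  rewrite <- V. rewrite <- csum_scal. apply csum_ext. intros i Hi. cbv zeta.
  set (s := Z.of_nat i).
  replace (Z.of_nat (Z.to_nat t + i)) with (t + s)%Z by lia.
  replace (zpow q ((t + s) * (t + s))) with (zpow q (t * t) * zpow q (s * (s + 2 * t)))
    by (rewrite <- !zpow_add by nia; f_equal; ring).
  replace (t + s - t)%Z with s by ring.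
  replace (M - (t + s))%Z with (M - t - s)%Z by ring.
  replace (t + s + t)%Z with (s + 2 * t)%Z by ring.
  ring.
Qed.

(** * Reduction of the multisum to a single sum *)

(* The sum over the last d variables, when the two before them have the values p and m. *)
Fixpoint chain (q : C) (N d p m : nat) : C :=
  match d with
  | O => qbin q (Z.of_nat p) (Z.of_nat m)
  | S d' => csum (S N) (fun i => Cpow q (i * i)
      * qbin q (Z.of_nat p + Z.of_nat m - Z.of_nat i) (2 * Z.of_nat m) * chain q N d' m i)
  end.

(** Bridge between the nested sums of [chain] and the lists over which [boxsum] runs. *)
Fixpoint chain_weight (q : C) (p m : nat) (l : list nat) : C :=
  match l with
  | nil => qbin q (Z.of_nat p) (Z.of_nat m)
  | i :: l' => Cpow q (i * i)
      * qbin q (Z.of_nat p + Z.of_nat m - Z.of_nat i) (2 * Z.of_nat m) * chain_weight q m i l'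
  end.

Lemma boxsum_ext (d N : nat) (f g : list nat -> C) :
  (forall l, length l = d -> f l = g l) -> boxsum d N f = boxsum d N g.
Proof.
  revert f g. induction d as [|d IH]; intros f g H; cbn [boxsum].
  - apply H. reflexivity.
  - apply csum_ext. intros a _. apply IH. intros l Hl. apply H. simpl. now rewrite Hl.
Qed.

Lemma boxsum_scal (d N : nat) (c : C) (f : list nat -> C) :
  boxsum d N (fun l => c * f l) = c * boxsum d N f.
Proof.
  revert f. induction d as [|d IH]; intros f; cbn [boxsum]; [reflexivity|].
  rewrite <- csum_scal. apply csum_ext. intros a _. apply (IH (fun l => f (a :: l))).
Qed.

Lemma boxsum_chain_weight (q : C) (N d p m : nat) :
  boxsum d N (chain_weight q p m) = chain q N d p m.
Proof.
  revert p m. induction d as [|d IH]; intros p m; [reflexivity|].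
  cbn [boxsum]. cbn [chain]. apply csum_ext. intros i _.
  simpl chain_weight. rewrite <- IH. apply boxsum_scal.
Qed.

Lemma cprod_head (n : nat) (f : nat -> C) :
  cprod (S n) f = f 0%nat * cprod n (fun i => f (S i)).
Proof.
  induction n as [|n IH]; [simpl; ring|].
  change (cprod (S (S n)) f) with (cprod (S n) f * f (S n)). rewrite IH. simpl. ring.
Qed.

Lemma cprod_ext (n : nat) (f g : nat -> C) :
  (forall i, (i < n)%nat -> f i = g i) -> cprod n f = cprod n g.
Proof.
  induction n as [|n IH]; intros H; simpl; [reflexivity|].
  rewrite IH, H; [reflexivity | lia | intros; apply H; lia].
Qed.

Lemma chain_weight_eq (q : C) (l : list nat) (p m : nat) :
  let f j := Z.of_nat (nth j (p :: m :: l) O) in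
  cprod (length l) (fun i => qbin q (f i + f (S i) - f (S (S i))) (2 * f (S i)))
  * qbin q (f (length l)) (f (S (length l)))
  * Cpow q (fold_right Nat.add O (map (fun x => x * x)%nat l))
  = chain_weight q p m l.
Proof.
  revert p m. induction l as [|i l IH]; intros p m; cbv zeta.
  - simpl. ring.
  - simpl length. rewrite cprod_head.
    change (chain_weight q p m (i :: l)) with (Cpow q (i * i)
      * qbin q (Z.of_nat p + Z.of_nat m - Z.of_nat i) (2 * Z.of_nat m) * chain_weight q m i l).
    rewrite <- IH. cbv zeta. simpl map. simpl fold_right. rewrite Cpow_add_r.
    simpl nth. ring.
Qed.

(** Since k >= 4, the variables m_1 = L and m_2 = i always exist; they are the two predecessors from
    which [chain_weight] starts. *)
Lemma summand_eq (q : C) (d L i : nat) (l : list nat) :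
  (Cmod q < 1)%R -> length l = d ->
  summand (d + 4) q (L :: i :: l)
  = Cpow q (L * L) * iqfac q (2 * Z.of_nat L) * (Cpow q (i * i) * chain_weight q L i l).
Proof.
  intros Hq Hl. rewrite <- chain_weight_eq. cbv zeta. rewrite Hl. unfold summand.
  rewrite iqfac_pos by lia. unfold qfac.
  replace (Z.to_nat (2 * Z.of_nat L)) with (2 * nth 0 (L :: i :: l) 0)%nat by (simpl nth; lia).
  replace (d + 4 - 4)%nat with d by lia.
  replace (d + 4 - 3 - 1)%nat with d by lia. replace (d + 4 - 2 - 1)%nat with (S d) by lia.
  rewrite (cprod_ext d _ (fun i0 => qbin q
    (Z.of_nat (nth i0 (L :: i :: l) 0%nat) + Z.of_nat (nth (S i0) (L :: i :: l) 0%nat)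
     - Z.of_nat (nth (S (S i0)) (L :: i :: l) 0%nat))
    (2 * Z.of_nat (nth (S i0) (L :: i :: l) 0%nat)))).
  2:{ intros j _. replace (j + 2 - 1 - 1)%nat with j by lia.
      replace (j + 2 - 1)%nat with (S j) by lia.
      replace (j + 2 + 1 - 1)%nat with (S (S j)) by lia. reflexivity. }
  simpl map. simpl fold_right. rewrite !Cpow_add_r. unfold Cdiv. ring.
Qed.

Lemma partial_multisum_chain (q : C) (d N : nat) :
  (Cmod q < 1)%R ->
  partial_multisum (d + 4) q N = csum (S N) (fun L =>
    Cpow q (L * L) * iqfac q (2 * Z.of_nat L)
    * csum (S N) (fun i => Cpow q (i * i) * chain q N d L i)).
Proof.
  intros Hq. unfold partial_multisum. replace (d + 4 - 2)%nat with (S (S d)) by lia.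
  cbn [boxsum]. apply csum_ext. intros L _. rewrite <- csum_scal.
  apply csum_ext. intros i _. rewrite <- boxsum_chain_weight, <- !boxsum_scal.
  apply boxsum_ext. intros l Hl. now apply summand_eq.
Qed.

Lemma fib_SS (n : nat) : fib (S (S n)) = (fib (S n) + fib n)%nat.
Proof. reflexivity. Qed.

Lemma fib_pos (n : nat) : (1 <= fib (S n))%nat.
Proof.
  induction n as [|n IH]; [simpl; lia|]. rewrite fib_SS. lia.
Qed.

(** For a = b, [Phi] contains (q)_p twice: one copy is the numerator of the binomial, the other
    belongs to [seed]. *)
Lemma Phi_diag (q : C) (p m : nat) (N : nat) :
  (Cmod q < 1)%R -> (m <= N)%nat ->
  csum (S N) (fun j => theta q j * Phi q (Z.of_nat j) (Z.of_nat j) (Z.of_nat p) (Z.of_nat m))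
  = qbin q (Z.of_nat p) (Z.of_nat m).
Proof.
  intros Hq Hm. rewrite qbin_eq by exact Hq. unfold Phi.
  destruct (Nat.le_gt_cases m p) as [H|H].
  - replace (Z.of_nat p - Z.of_nat m)%Z with (Z.of_nat (p - m)) by lia.
    rewrite <- Cmult_assoc, <- seed by (auto; lia). cbv zeta.
    rewrite (csum_trunc (S m)) by
      (try lia; intros i Hi; rewrite (iqfac_neg q (Z.of_nat m - Z.of_nat i)) by lia; ring).
    rewrite Nat2Z.id, <- csum_scal. apply csum_ext. intros j _.
    replace (Z.of_nat m + Z.of_nat (p - m))%Z with (Z.of_nat p) by lia.
    rewrite Z.add_simpl_r, Z.sub_add. ring.
  - rewrite (iqfac_neg q (Z.of_nat p - Z.of_nat m)) by lia.
    rewrite csum_zero; [ring|]. intros j _.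
    rewrite (iqfac_neg q (Z.of_nat p - Z.of_nat m - Z.of_nat j)) by lia. ring.
Qed.

(** Each transform adds (F_{d+2} j)^2 to the exponent, so d of them contribute F_2^2 + ... +
    F_{d+1}^2 = F_{d+1} F_{d+2} - 1 times j^2. The missing F_1^2 is the j^2 already present in
    [theta]. The bounds p, m <= N ensure that the box cuts off no nonzero term. *)
Lemma chain_eq (q : C) (N d p m : nat) :
  (Cmod q < 1)%R -> (p <= N)%nat -> (m <= N)%nat ->
  chain q N d p m = csum (S N) (fun j =>
    theta q j * Cpow q ((fib (S d) * fib (S (S d)) - 1) * (j * j))
    * Phi q (Z.of_nat (fib (S (S d)) * j)) (Z.of_nat (fib (S d) * j))
        (Z.of_nat p) (Z.of_nat m)).
Proof.
  intros Hq. revert p m. induction d as [|d IH]; intros p m Hp Hm.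
  - cbn [chain]. rewrite <- (Phi_diag q p m N Hq Hm). apply csum_ext. intros j _.
    simpl fib. rewrite !Nat.mul_1_l. simpl. ring.
  - cbn [chain].
    rewrite (csum_ext _ _ (fun i => csum (S N) (fun j =>
      theta q j * Cpow q ((fib (S d) * fib (S (S d)) - 1) * (j * j)) *
      (zpow q (Z.of_nat i * Z.of_nat i)
       * qbin q (Z.of_nat p + Z.of_nat m - Z.of_nat i) (2 * Z.of_nat m)
       * Phi q (Z.of_nat (fib (S (S d)) * j)) (Z.of_nat (fib (S d) * j))
        (Z.of_nat m) (Z.of_nat i))))).
    2:{ intros i Hi. rewrite IH by lia. rewrite <- csum_scal. apply csum_ext.
        intros j _. rewrite (zpow_to_nat q (i * i) (Z.of_nat i * Z.of_nat i)) by lia. ring. }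
    rewrite csum_swap. apply csum_ext. intros j _. rewrite csum_scal.
    assert (Bu := burge q (Z.of_nat (fib (S (S d)) * j)) (Z.of_nat (fib (S d) * j))
      (Z.of_nat p) (Z.of_nat m) N Hq ltac:(lia) ltac:(lia) ltac:(lia)).
    cbv zeta in Bu. rewrite Bu. clear Bu.
    set (u := fib (S d)). set (v := fib (S (S d))).
    replace (fib (S (S (S d)))) with (v + u)%nat by reflexivity.
    replace (Z.of_nat (v * j) + Z.of_nat (u * j))%Z with (Z.of_nat ((v + u) * j)) by lia.
    rewrite <- (zpow_to_nat q (v * j * (v * j)) (Z.of_nat (v * j) * Z.of_nat (v * j))) by lia.
    replace ((v * (v + u) - 1) * (j * j))%nat
      with ((u * v - 1) * (j * j) + v * j * (v * j))%nat.
    + rewrite Cpow_add_r. ring.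
    + assert (1 <= u)%nat by apply fib_pos. assert (1 <= v)%nat by apply fib_pos.
      assert (1 <= u * v)%nat by nia.
      replace (v * (v + u) - 1)%nat with ((u * v - 1) + v * v)%nat by nia. ring.
Qed.

(* The contribution of m_1 = L after the other summations, with t j = F_{k-1} j. *)
Definition coeff (q : C) (e t L : nat) : C :=
  Cpow q (L * L) * csum (S L) (fun j => theta q j * Cpow q (e * (j * j))
    * (iqfac q (Z.of_nat L - Z.of_nat (t * j)) * iqfac q (Z.of_nat L + Z.of_nat (t * j)))).

(** The factor 1/(q)_(2 m_1) takes the place of a binomial with infinite upper entry, so the last
    transform is [burge_inf], whose (q)_(2L) cancels it. The equality is exact for every N. *)
Lemma partial_multisum_coeff (q : C) (d N : nat) :
  (Cmod q < 1)%R ->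
  partial_multisum (d + 4) q N = csum (S N)
    (coeff q (fib (S (S d)) * fib (S (S (S d))) - 1) (fib (S (S (S d))))).
Proof.
  intros Hq. rewrite partial_multisum_chain by exact Hq.
  apply csum_ext. intros L HL. unfold coeff.
  set (u := fib (S d)). set (v := fib (S (S d))).
  replace (fib (S (S (S d)))) with (v + u)%nat by reflexivity.
  assert (Hu : (1 <= u)%nat) by apply fib_pos. assert (Hv : (1 <= v)%nat) by apply fib_pos.
  rewrite <- Cmult_assoc. f_equal.
  (* As F_{k-1} >= 1, terms with j > L vanish; extending the range to N makes it independent of L
     and of i, so that the sums can be interchanged. *)
  rewrite <- (csum_trunc (S L) (S N)).
  2: lia.
  2:{ intros j Hj. rewrite (iqfac_neg q (Z.of_nat L - _)) by nia. ring. }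
  rewrite (csum_ext _ _ (fun i => csum (S N) (fun j =>
      theta q j * Cpow q ((u * v - 1) * (j * j)) *
      (zpow q (Z.of_nat i * Z.of_nat i)
       * Phi q (Z.of_nat (v * j)) (Z.of_nat (u * j)) (Z.of_nat L) (Z.of_nat i))))).
  2:{ intros i Hi. rewrite chain_eq by (auto; lia). rewrite <- csum_scal. apply csum_ext.
      intros j _. rewrite (zpow_to_nat q (i * i) (Z.of_nat i * Z.of_nat i)) by lia.
      unfold u, v. ring. }
  rewrite csum_swap, <- csum_scal. apply csum_ext. intros j _. rewrite csum_scal.
  assert (Bu := burge_inf q (Z.of_nat (v * j)) (Z.of_nat (u * j)) (Z.of_nat L) N Hq
    ltac:(lia) ltac:(lia) ltac:(lia)).
  cbv zeta in Bu. rewrite Bu. clear Bu.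
  replace (Z.of_nat (v * j) + Z.of_nat (u * j))%Z with (Z.of_nat ((v + u) * j)) by lia.
  rewrite <- (zpow_to_nat q (v * j * (v * j)) (Z.of_nat (v * j) * Z.of_nat (v * j))) by lia.
  replace ((v * (v + u) - 1) * (j * j))%nat
    with ((u * v - 1) * (j * j) + v * j * (v * j))%nat.
  - rewrite Cpow_add_r.
    match goal with |- ?x * (?c * (?y * (?g * ?a * ?b))) = ?r =>
      transitivity (g * x * (c * y * (a * b))); [ring|] end.
    rewrite qfac_iqfac by (auto; lia). ring.
  - assert (1 <= u * v)%nat by nia.
    replace (v * (v + u) - 1)%nat with ((u * v - 1) + v * v)%nat by nia. ring.
Qed.

(** The weight 1/(q)_(N-L) turns the sum over L into an instance of [durfee]. For fixed L it tends
    to the constant 1/(q)_infinity, so it disappears from the limit up to that factor. *)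
Lemma coeff_durfee (q : C) (e t N : nat) :
  (Cmod q < 1)%R -> (1 <= t)%nat ->
  csum (S N) (fun L => coeff q e t L * iqfac q (Z.of_nat N - Z.of_nat L))
  = csum (S N) (fun j => theta q j * Cpow q ((e + t * t) * (j * j))
    * (iqfac q (Z.of_nat N - Z.of_nat (t * j)) * iqfac q (Z.of_nat N + Z.of_nat (t * j)))).
Proof.
  intros Hq Ht. unfold coeff.
  rewrite (csum_ext _ _ (fun L => csum (S N) (fun j =>
    theta q j * Cpow q (e * (j * j)) *
    (zpow q (Z.of_nat L * Z.of_nat L) * iqfac q (Z.of_nat L - Z.of_nat (t * j))
     * iqfac q (Z.of_nat L + Z.of_nat (t * j)) * iqfac q (Z.of_nat N - Z.of_nat L))))).
  2:{ intros L HL. rewrite <- (csum_trunc (S L) (S N)).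
      2: lia.
      2:{ intros j Hj. rewrite (iqfac_neg q (Z.of_nat L - _)) by nia. ring. }
      rewrite Cmult_comm, Cmult_assoc, <- csum_scal. apply csum_ext. intros j _.
      rewrite (zpow_to_nat q (L * L) (Z.of_nat L * Z.of_nat L)) by lia. ring. }
  rewrite csum_swap. apply csum_ext. intros j _. rewrite csum_scal.
  assert (Du := durfee q (Z.of_nat (t * j)) N Hq ltac:(lia)).
  cbv zeta in Du. rewrite Du. clear Du.
  rewrite <- (zpow_to_nat q (t * j * (t * j)) (Z.of_nat (t * j) * Z.of_nat (t * j))) by lia.
  replace ((e + t * t) * (j * j))%nat with (e * (j * j) + t * j * (t * j))%nat by ring.
  rewrite Cpow_add_r. ring.
Qed.

(** * Jacobi's triple product and the limit *)

(** Up to the factor (Q)_(m+n), the terms j >= 0 of the sum of (-1)^j Q^(j(j-1)/2) z^j [m+n; m-j]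
    over all integers j. The terms at -j have the same shape with m and n exchanged and w = Q/z for
    z; the relation z w = Q replaces the division. A common J lets m and n grow without changing the
    range. *)
Definition half_theta (z Q : C) (m n J : nat) : C :=
  csum (S J) (fun j => Cpow (-(1)) j * Cpow Q (tri j) * Cpow z j
    * iqfac Q (Z.of_nat n + Z.of_nat j) * iqfac Q (Z.of_nat m - Z.of_nat j)).

(* The term j = 0 is counted in both halves. *)
Definition fin_theta (z w Q : C) (m n J : nat) : C :=
  qfac Q (Z.of_nat m + Z.of_nat n)
  * (half_theta z Q m n J + half_theta w Q n m J
     - iqfac Q (Z.of_nat n) * iqfac Q (Z.of_nat m)).

(** Creative telescoping in m on each half separately. The certificates do not vanish at j = 0;
    their two boundary terms together account for the change of the middle term, which is counted
    twice. *)
Lemma fin_theta_succ (z w Q : C) (m n J : nat) :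
  (Cmod Q < 1)%R -> z * w = Q -> (S m <= J)%nat -> (n <= J)%nat ->
  fin_theta z w Q (S m) n J = (1 - z * Cpow Q m) * fin_theta z w Q m n J.
Proof.
  intros HQ Hzw HmJ HnJ.
  set (M := Z.of_nat m). set (T := qfac Q (M + Z.of_nat n)). set (y := zpow Q (M + 1)).
  set (l := zpow Q (Z.of_nat n)).
  assert (Em : iqfac Q M = (1 - y) * iqfac Q (M + 1))
    by (unfold y; rewrite <- iqfac_pred by exact HQ; f_equal; ring).
  assert (ET : qfac Q (M + 1 + Z.of_nat n) = T * (1 - y * l)).
  { replace (M + 1 + Z.of_nat n)%Z with (M + Z.of_nat n + 1)%Z by ring.
    rewrite qfac_succ by lia. unfold y, l. rewrite <- zpow_add by lia.
    do 3 f_equal. ring. }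
  assert (H1 : T * (1 - y * l) * half_theta z Q (S m) n J
               - (1 - z * Cpow Q m) * T * half_theta z Q m n J
             = T * y * iqfac Q (Z.of_nat n - 1) * iqfac Q (M + 1)).
  { unfold half_theta.
    rewrite csum_comb.
    set (g := fun j : nat => - (T * (Cpow (-(1)) j * Cpow Q (tri j) * Cpow z j)
      * zpow Q (M + 1 - Z.of_nat j) * iqfac Q (Z.of_nat n + Z.of_nat j - 1)
      * iqfac Q (M + 1 - Z.of_nat j))).
    rewrite (csum_telescope _ _ g).
    - unfold g. rewrite (iqfac_neg Q (M + 1 - Z.of_nat (S J))) by lia.
      change (Z.of_nat 0) with 0%Z. rewrite Z.sub_0_r, Z.add_0_r. simpl. unfold y. ring.
    - intros j Hj. unfold g. set (i := Z.of_nat j).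
      replace (Z.of_nat (S m)) with (M + 1)%Z by lia.
      replace (Z.of_nat (S j)) with (i + 1)%Z by lia. fold M.
      destruct (Z_lt_le_dec (M + 1) i) as [H|H].
      { rewrite (iqfac_neg Q (M - i)), (iqfac_neg Q (M + 1 - i)),
          (iqfac_neg Q (M + 1 - (i + 1))) by lia. ring. }
      replace (M + 1 - (i + 1))%Z with (M - i)%Z by ring.
      replace (Z.of_nat n + (i + 1) - 1)%Z with (Z.of_nat n + i)%Z by ring.
      rewrite (iqfac_pred Q (Z.of_nat n + i)) by exact HQ.
      simpl tri. rewrite !Cpow_add_r, !Cpow_S.
      rewrite (zpow_add Q (Z.of_nat n)) by lia. fold l.
      replace y with (zpow Q (M + 1 - i) * zpow Q i)
        by (unfold y; rewrite <- !zpow_add by lia; f_equal; ring).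
      (* At i = M + 1 the splitting of Q^m used below would need a negative exponent, but there
         1/(Q)_(M-i) is 0. *)
      destruct (Z.eq_dec (M + 1) i) as [E|E].
      + rewrite (iqfac_neg Q (M - i)) by lia. replace (M + 1 - i)%Z with 0%Z by lia.
        rewrite zpow_0. ring.
      + replace (Cpow Q m) with (zpow Q (M - i) * zpow Q i)
          by (rewrite <- !zpow_add, <- zpow_of_nat by lia; f_equal; fold M; ring).
        replace (iqfac Q (M - i)) with ((1 - zpow Q (M + 1 - i)) * iqfac Q (M + 1 - i))
          by (rewrite <- iqfac_pred by exact HQ; f_equal; ring).
        rewrite (zpow_to_nat Q j i) by reflexivity. ring. }
  assert (H2 : T * (1 - y * l) * half_theta w Q n (S m) J
               - (1 - z * Cpow Q m) * T * half_theta w Q n m J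
             = T * z * Cpow Q m * iqfac Q M * iqfac Q (Z.of_nat n)).
  { unfold half_theta.
    rewrite csum_comb.
    set (g := fun j : nat => - (T * (Cpow (-(1)) j * Cpow Q (tri j) * Cpow w j)
      * z * Cpow Q m * iqfac Q (M + Z.of_nat j) * iqfac Q (Z.of_nat n - Z.of_nat j))).
    rewrite (csum_telescope _ _ g).
    - unfold g. rewrite (iqfac_neg Q (Z.of_nat n - Z.of_nat (S J))) by lia.
      change (Z.of_nat 0) with 0%Z. rewrite Z.sub_0_r, Z.add_0_r. simpl. ring.
    - intros j Hj. unfold g. set (i := Z.of_nat j).
      replace (Z.of_nat (S m)) with (M + 1)%Z by lia.
      replace (Z.of_nat (S j)) with (i + 1)%Z by lia. fold M.
      destruct (Z_lt_le_dec (Z.of_nat n) i) as [H|H].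
      { rewrite (iqfac_neg Q (Z.of_nat n - i)), (iqfac_neg Q (Z.of_nat n - (i + 1)))
          by lia. ring. }
      replace (Z.of_nat n - (i + 1))%Z with (Z.of_nat n - i - 1)%Z by ring.
      replace (M + (i + 1))%Z with (M + 1 + i)%Z by ring.
      replace (iqfac Q (M + i)) with ((1 - zpow Q (M + 1 + i)) * iqfac Q (M + 1 + i))
        by (rewrite <- iqfac_pred by exact HQ; f_equal; ring).
      rewrite (iqfac_pred Q (Z.of_nat n - i)) by exact HQ.
      simpl tri. rewrite !Cpow_add_r, !Cpow_S.
      replace l with (zpow Q (Z.of_nat n - i) * zpow Q i)
        by (unfold l; rewrite <- !zpow_add by lia; f_equal; ring).
      rewrite (zpow_add Q (M + 1)) by lia. fold y.
      replace y with (z * w * Cpow Q m)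
        by (unfold y; rewrite Hzw, <- Cpow_S; apply zpow_to_nat; lia).
      rewrite (zpow_to_nat Q j i) by reflexivity. ring. }
  unfold fin_theta. fold M. replace (Z.of_nat (S m)) with (M + 1)%Z by lia. rewrite ET.
  fold T.
  set (a := half_theta z Q (S m) n J) in *. set (a' := half_theta z Q m n J) in *.
  set (b := half_theta w Q n (S m) J) in *. set (b' := half_theta w Q n m J) in *.
  set (r := 1 - z * Cpow Q m).
  transitivity ((T * (1 - y * l) * a - r * T * a') + (T * (1 - y * l) * b - r * T * b')
    + r * T * (a' + b') - T * (1 - y * l) * iqfac Q (Z.of_nat n) * iqfac Q (M + 1)); [ring|].
  unfold r in *. rewrite H1, H2. rewrite (iqfac_pred Q (Z.of_nat n)) by exact HQ. fold l.
  rewrite Em. ring.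
Qed.

Lemma fin_theta_sym (z w Q : C) (m n J : nat) :
  fin_theta z w Q m n J = fin_theta w z Q n m J.
Proof. unfold fin_theta. rewrite Z.add_comm. ring. Qed.

(* Finite form of Jacobi's triple product. *)
Lemma fin_theta_prod (z w Q : C) (m n J : nat) :
  (Cmod Q < 1)%R -> z * w = Q -> (m <= J)%nat -> (n <= J)%nat ->
  fin_theta z w Q m n J = qpoch z Q m * qpoch w Q n.
Proof.
  intros HQ Hzw. revert n. induction m as [|m IH]; intros n Hm Hn.
  - induction n as [|n IHn].
    + assert (E : forall x, half_theta x Q 0 0 J = 1).
      { intros x. unfold half_theta. rewrite (csum_trunc 1) by
          (try lia; intros i Hi;
           rewrite (iqfac_neg Q (Z.of_nat 0 - Z.of_nat i)) by lia; ring).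
        simpl. rewrite iqfac_0. ring. }
      unfold fin_theta. rewrite !E. simpl. rewrite qfac_0, iqfac_0. unfold qpoch. simpl. ring.
    + rewrite fin_theta_sym, fin_theta_succ, fin_theta_sym, IHn
        by (auto; try lia; rewrite Cmult_comm; exact Hzw).
      unfold qpoch. simpl. ring.
  - rewrite fin_theta_succ, IH by (auto; lia). unfold qpoch. simpl. ring.
Qed.

Lemma tri_sq (j : nat) : (j * j = 2 * tri j + j)%nat.
Proof. induction j as [|j IH]; simpl tri; lia. Qed.

(** By j*j = 2 tri j + j, the exponent tri j + A j^2 equals (2A+1) tri j + A j. This reveals the
    base Q = q^(2A+1) and z = q^A, and the factor 1 + q^j of [theta] supplies the other half, with w
    = q^(A+1). One j^2 of A j^2 lies in [theta], hence A - 1. *)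
Lemma theta_triple_product (q : C) (A : nat) (N : nat) :
  (Cmod q < 1)%R -> (1 <= A)%nat ->
  let Q := Cpow q (2 * A + 1) in
  csum (S N) (fun j => theta q j * Cpow q ((A - 1) * (j * j))
    * (qfac Q (Z.of_nat (2 * N)) * iqfac Q (Z.of_nat N + Z.of_nat j)
       * iqfac Q (Z.of_nat N - Z.of_nat j)))
  = qpoch (Cpow q A) Q N * qpoch (Cpow q (A + 1)) Q N.
Proof.
  intros Hq HA Q.
  assert (HQ : (Cmod Q < 1)%R)
    by (apply Rle_lt_trans with (Cmod q); [apply Cmod_pow_lt; [exact Hq|lia] | exact Hq]).
  rewrite <- (fin_theta_prod _ _ Q N N N); auto.
  2:{ rewrite <- Cpow_add_r. unfold Q. f_equal. lia. }
  unfold fin_theta, half_theta. rewrite !csum_head.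
  change (Z.of_nat 0) with 0%Z. rewrite Z.sub_0_r, Z.add_0_r.
  replace (Z.of_nat N + Z.of_nat N)%Z with (Z.of_nat (2 * N)) by lia.
  set (T := qfac Q (Z.of_nat (2 * N))). set (r := iqfac Q (Z.of_nat N)).
  match goal with |- ?x + csum N ?f = _ * (?a + csum N ?g + (?b + csum N ?h) - _) =>
    replace (csum N f) with (T * (csum N g + csum N h));
    [simpl; rewrite Nat.mul_0_r; simpl; ring|] end.
  rewrite <- csum_plus, <- csum_scal. apply csum_ext. intros i _.
  set (j := S i).
  assert (E : theta q j * Cpow q ((A - 1) * (j * j))
     = Cpow (-(1)) j * Cpow Q (tri j) * (Cpow (Cpow q A) j + Cpow (Cpow q (A + 1)) j)).
  { unfold Q. rewrite <- !Cpow_mult_r.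
    change (theta q j) with (Cpow (-(1)) j * Cpow q (tri j + j * j) * (1 + Cpow q j)).
    replace ((A + 1) * j)%nat with (A * j + j)%nat by ring. rewrite (Cpow_add_r q (A * j)).
    transitivity (Cpow (-(1)) j * (Cpow q (tri j + j * j) * Cpow q ((A - 1) * (j * j)))
      * (1 + Cpow q j)); [ring|].
    transitivity (Cpow (-(1)) j * (Cpow q ((2 * A + 1) * tri j) * Cpow q (A * j))
      * (1 + Cpow q j)); [|ring].
    rewrite <- !Cpow_add_r. do 3 f_equal.
    assert (H := tri_sq j). replace A with (S (A - 1)) by lia. set (B := (A - 1)%nat).
    replace (S B - 1)%nat with B by lia. rewrite H. ring. }
  rewrite E. ring.
Qed.

Lemma theta_bound (q : C) (e j : nat) :
  (Cmod q < 1)%R -> (Cmod (theta q j * Cpow q (e * (j * j))) <= 2 * Cmod q ^ j)%R.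
Proof.
  intros Hq. destruct j as [|i].
  - simpl theta. rewrite !Nat.mul_0_r. simpl. rewrite Cmult_1_l, Cmod_1. lra.
  - set (j := S i).
    change (theta q j) with (Cpow (-(1)) j * Cpow q (tri j + j * j) * (1 + Cpow q j)).
    replace (tri j + j * j)%nat with (j + (tri j + i * j))%nat by (unfold j; ring).
    rewrite Cpow_add_r, !Cmod_mult, (Cmod_pow (-(1))), Cmod_opp, Cmod_1, pow1, Cmod_pow.
    assert (H0 : (0 <= Cmod q ^ j)%R) by (apply pow_le, Cmod_ge_0).
    assert (H1 := Cmod_pow_le q (tri j + i * j) Hq).
    assert (H2 := Cmod_pow_le q (e * (j * j)) Hq).
    assert (H3 : (Cmod (1 + Cpow q j) <= 2)%R).
    { eapply Rle_trans; [apply Cmod_triangle|]. rewrite Cmod_1.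
      assert (H := Cmod_pow_le q j Hq). lra. }
    set (a := Cmod (Cpow q (tri j + i * j))) in *. set (b := Cmod (Cpow q (e * (j * j)))) in *.
    set (c := Cmod (1 + Cpow q j)) in *. set (p := (Cmod q ^ j)%R) in *.
    assert (0 <= a)%R by apply Cmod_ge_0. assert (0 <= b)%R by apply Cmod_ge_0.
    assert (0 <= c)%R by apply Cmod_ge_0.
    replace (1 * (p * a) * c * b)%R with (p * (a * b * c))%R by ring.
    rewrite (Rmult_comm 2). apply Rmult_le_compat_l; [exact H0|].
    assert (a * b <= 1)%R by nra. assert (0 <= a * b)%R by nra. nra.
Qed.

Lemma Cmod_mult_le (x y : C) (a b : R) :
  (Cmod x <= a)%R -> (Cmod y <= b)%R -> (Cmod (x * y) <= a * b)%R.
Proof. intros. rewrite Cmod_mult. apply Rmult_le_compat; auto using Cmod_ge_0. Qed.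

(** The factor q^(L*L) alone gives the decay |q|^L; the inner sum is bounded uniformly in L. *)
Lemma coeff_bound (q : C) (e t : nat) :
  (Cmod q < 1)%R ->
  exists K, (0 <= K)%R /\ forall L, (Cmod (coeff q e t L) <= K * Cmod q ^ L)%R.
Proof.
  intros Hq. destruct (iqfac_bound q Hq) as [K [HK HB]]. assert (H0 := Cmod_ge_0 q).
  exists (2 * (K * K) / (1 - Cmod q))%R. split.
  { apply Rdiv_le_0_compat; nra. }
  intros L. unfold coeff. rewrite Rmult_comm. apply Cmod_mult_le.
  - replace (L * L)%nat with (L + (L * L - L))%nat by nia.
    rewrite Cpow_add_r, <- (Rmult_1_r (Cmod q ^ L)).
    apply Cmod_mult_le; [rewrite Cmod_pow; lra | now apply Cmod_pow_le].
  - replace (2 * (K * K) / (1 - Cmod q))%R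
      with (2 * (K * K) / (1 - Cmod q) * Cmod q ^ 0)%R by (simpl; ring).
    apply csum_Cmod_geom; [nra | lra |]. intros j. simpl Nat.add.
    replace (2 * (K * K) * Cmod q ^ j)%R with (2 * Cmod q ^ j * (K * K))%R by ring.
    apply Cmod_mult_le; [now apply theta_bound | now apply Cmod_mult_le].
Qed.

(** In [theta_triple_product] the kernel (Q)_(2N) / ((Q)_(N+j) (Q)_(N-j)) tends to 1/P3, so
    Tannery's theorem equates the theta series divided by P3 with P1 P2. *)
Lemma clim_theta (q P1 P2 P3 : C) (A : nat) :
  (Cmod q < 1)%R -> (1 <= A)%nat ->
  let Q := Cpow q (2 * A + 1) in
  clim (qpoch (Cpow q A) Q) P1 -> clim (qpoch (Cpow q (A + 1)) Q) P2 ->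
  clim (qpoch Q Q) P3 ->
  clim (fun n => csum n (fun j => theta q j * Cpow q ((A - 1) * (j * j)))) (P1 * P2 * P3).
Proof.
  intros Hq HA Q H1 H2 H3.
  assert (HQ : (Cmod Q < 1)%R)
    by (apply Rle_lt_trans with (Cmod q); [apply Cmod_pow_lt; [exact Hq|lia] | exact Hq]).
  assert (HP3 := qpoch_lim_neq_0 Q P3 HQ H3).
  destruct (iqfac_bound Q HQ) as [K [HK HB]].
  destruct (qpoch_bound Q Q HQ) as [K' [HK' HB']].
  set (v := fun j => theta q j * Cpow q ((A - 1) * (j * j))).
  destruct (clim_dominated (2 * (K' * K * K)) (Cmod q)
    (fun N j => v j * (qfac Q (Z.of_nat (2 * N)) * iqfac Q (Z.of_nat N + Z.of_nat j)
       * iqfac Q (Z.of_nat N - Z.of_nat j))) (fun j => / P3 * v j)) as [S [HS1 HS2]].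
  - apply Rmult_le_pos; [lra|]. apply Rmult_le_pos; [apply Rmult_le_pos|]; lra.
  - split; [apply Cmod_ge_0 | exact Hq].
  - intros N j. replace (2 * (K' * K * K) * Cmod q ^ j)%R
      with (2 * Cmod q ^ j * (K' * K * K))%R by ring.
    apply Cmod_mult_le; [now apply theta_bound|].
    apply Cmod_mult_le; [apply Cmod_mult_le|]; auto. apply HB'.
  - intros j. apply clim_eq with (v j * (P3 * / P3 * / P3)); [|field; exact HP3].
    apply clim_scal, clim_mult; [apply clim_mult|].
    + apply clim_ext with (fun N => qfac Q (Z.of_nat (2 * N) + 0)).
      { intros N. now rewrite Z.add_0_r. }
      apply (clim_subseq (fun N => qfac Q (Z.of_nat N + 0)) (fun N => 2 * N)%nat);
        [intros; lia | now apply clim_qfac].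
    + now apply clim_iqfac.
    + now apply (clim_iqfac Q P3 (- Z.of_nat j)).
  - assert (E : S = P1 * P2).
    { apply clim_unique with (1 := HS2).
      apply clim_ext with (fun N => qpoch (Cpow q A) Q N * qpoch (Cpow q (A + 1)) Q N).
      - intros N. symmetry. now apply theta_triple_product.
      - now apply clim_mult. }
    apply clim_ext with (fun n => P3 * csum n (fun j => / P3 * v j)).
    { intros n. rewrite csum_scal. field. exact HP3. }
    apply clim_eq with (P3 * S); [now apply clim_scal | rewrite E; ring].
Qed.

(** Tannery's theorem applies to both sides of [coeff_durfee]: the left tends to the series of
    [coeff] divided by P0, the right to T / P0^2. *)
Lemma clim_coeff (q T P0 : C) (e t : nat) :
  (Cmod q < 1)%R -> (1 <= t)%nat -> clim (qpoch q q) P0 ->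
  clim (fun n => csum n (fun j => theta q j * Cpow q ((e + t * t) * (j * j)))) T ->
  clim (fun n => csum n (coeff q e t)) (T / P0).
Proof.
  intros Hq Ht H0 HT. assert (HP0 := qpoch_lim_neq_0 q P0 Hq H0).
  destruct (iqfac_bound q Hq) as [K [HK HB]].
  destruct (coeff_bound q e t Hq) as [K' [HK' HB']].
  assert (Hr : (0 <= Cmod q < 1)%R) by (split; [apply Cmod_ge_0 | exact Hq]).
  set (v := fun j => theta q j * Cpow q ((e + t * t) * (j * j))) in *.
  destruct (clim_dominated (2 * (K * K)) (Cmod q)
    (fun N j => v j * (iqfac q (Z.of_nat N - Z.of_nat (t * j))
       * iqfac q (Z.of_nat N + Z.of_nat (t * j)))) (fun j => (/ P0 * / P0) * v j))
    as [S [HS1 HS2]]; auto.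
  { nra. }
  { intros N j. replace (2 * (K * K) * Cmod q ^ j)%R
      with (2 * Cmod q ^ j * (K * K))%R by ring.
    apply Cmod_mult_le; [now apply theta_bound | now apply Cmod_mult_le]. }
  { intros j. rewrite (Cmult_comm _ (v j)). apply clim_scal, clim_mult.
    - now apply (clim_iqfac q P0 (- Z.of_nat (t * j))).
    - now apply clim_iqfac. }
  destruct (clim_dominated (K' * K) (Cmod q)
    (fun N L => coeff q e t L * iqfac q (Z.of_nat N - Z.of_nat L))
    (fun L => / P0 * coeff q e t L)) as [S' [HS1' HS2']]; auto.
  { nra. }
  { intros N L. replace (K' * K * Cmod q ^ L)%R with (K' * Cmod q ^ L * K)%R by ring.
    now apply Cmod_mult_le. }
  { intros L. rewrite (Cmult_comm (/ P0)). apply clim_scal.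
    now apply (clim_iqfac q P0 (- Z.of_nat L)). }
  assert (ES : S = (/ P0 * / P0) * T).
  { apply clim_unique with (1 := HS1).
    apply clim_ext with (fun n => (/ P0 * / P0) * csum n v).
    - intros n. symmetry. apply csum_scal.
    - now apply clim_scal. }
  assert (ES' : S' = S).
  { apply clim_unique with (1 := HS2'). apply clim_ext with (2 := HS2).
    intros N. symmetry. now apply coeff_durfee. }
  apply clim_ext with (fun n => P0 * csum n (fun L => / P0 * coeff q e t L)).
  { intros n. rewrite csum_scal. field. exact HP0. }
  apply clim_eq with (P0 * S'); [now apply clim_scal|].
  rewrite ES', ES. field. exact HP0.
Qed.

Theorem theorem1p4 (q : C) (k : nat) :
  (Cmod q < 1)%R -> (4 <= k)%nat ->
  let A := (fib k * fib (k - 1))%nat in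
  let Q := Cpow q (2 * A + 1) in
  exists P1 P2 P3 P0 : C,
    is_qpoch_inf (Cpow q A) Q P1 /\
    is_qpoch_inf (Cpow q (A + 1)) Q P2 /\
    is_qpoch_inf (Cpow q (2 * A + 1)) Q P3 /\
    is_qpoch_inf q q P0 /\
    filterlim (fun N => partial_multisum k q N) eventually
      (locally (P1 * P2 * P3 / P0)).
Proof.
  intros Hq Hk A Q.
  assert (HQ : (Cmod Q < 1)%R)
    by (apply Rle_lt_trans with (Cmod q); [apply Cmod_pow_lt; [exact Hq|lia] | exact Hq]).
  destruct (qpoch_converges (Cpow q A) Q HQ) as [P1 H1].
  destruct (qpoch_converges (Cpow q (A + 1)) Q HQ) as [P2 H2].
  destruct (qpoch_converges Q Q HQ) as [P3 H3].
  destruct (qpoch_converges q q Hq) as [P0 H0].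
  exists P1, P2, P3, P0.
  do 4 (split; [now apply clim_filterlim|]).
  apply clim_filterlim.
  destruct (Nat.le_exists_sub 4 k Hk) as [d [-> _]].
  set (v := fib (S (S d))). set (t := fib (S (S (S d)))).
  assert (Hv : (1 <= v)%nat) by apply fib_pos. assert (Ht : (1 <= t)%nat) by apply fib_pos.
  assert (EA : A = ((t + v) * t)%nat).
  { unfold A. replace (d + 4)%nat with (S (S (S (S d)))) by lia.
    replace (S (S (S (S d))) - 1)%nat with (S (S (S d))) by lia. now rewrite fib_SS. }
  assert (HA : (1 <= A)%nat) by nia.
  apply clim_ext with (fun N => csum (S N) (coeff q (v * t - 1) t)).
  { intros N. symmetry. now apply partial_multisum_coeff. }
  apply (clim_subseq (fun N => csum N (coeff q (v * t - 1) t)) S); [intros; lia|].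
  apply clim_coeff; auto.
  (* Bailey's lemma contributes the last square: F_{k-2} F_{k-1} + F_{k-1}^2 = F_{k-1} F_k. *)
  replace (v * t - 1 + t * t)%nat with (A - 1)%nat by nia.
  now apply clim_theta.
Qed.
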